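(* Suppose the following hold. (A1) $\mathbb M$ is bounded on $L^2$; there exist positive functions $\phi,\phi^*\in L^2$ and a scalar $\rho>0$ with $\mathbb M\phi=\rho\phi$ and $\mathbb M^*\phi^*=\rho\phi^*$; $\phi$ and $\phi^*$ are the unique (up to scale) positive solutions in $L^2$ of these two problems; $\rho$ is a simple and isolated eigenvalue of $\mathbb M$ and is the largest eigenvalue of $\mathbb M$; and, when $\phi,\phi^*$ are scaled so that $\mathbb E[\phi(X_t)\phi^*(X_t)]=1$, $\lim_{\tau\to\infty}\rho^{-\tau}\mathbb M_\tau\psi(x)=\mathbb E[\psi(X_t)\phi^*(X_t)]\,\phi(x)$ for all $\psi\in L^2$. (A2) $\|\Pi_k\mathbb M-\mathbb M\|=o(1)$. (A3) $\|\widehat{\mathbf G}^o-\mathbf I\|=o_p(1)$ and $\|\widehat{\mathbf M}^o-\mathbf M^o\|=o_p(1)$. Let $\delta_k=\|\Pi_k\phi-\phi\|$ and $\delta_k^*=\|\Pi_k\phi^*-\phi^*\|$ under the normalization $\|\phi\|=\|\phi^*\|=1$, and let $\eta_{n,k},\eta^*_{n,k}$ be positive sequences, both $o(1)$, such that $$\|((\widehat{\mathbf G}^o)^{-1}\widehat{\mathbf M}^o-\mathbf M^o)\tilde c_k\|=O_p(\eta_{n,k}),\qquad \|((\widehat{\mathbf G}^o)^{-1}\widehat{\mathbf M}^{o\prime}-\mathbf M^{o\prime})\tilde c_k^*\|=O_p(\eta_{n,k}^* ).$$ Then: (a) $|\hat\rho-\rho|=O_p(\delta_k+\eta_{n,k})$;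 (b) $\|\hat\phi-\phi\|=O_p(\delta_k+\eta_{n,k})$; (c) $\|\hat\phi^*-\phi^*\|=O_p(\delta_k^*+\eta_{n,k}^* )$, where the rates in (b) and (c) hold under the scale normalizations $\|\phi\|=\|\hat\phi\|=\|\phi^*\|=\|\hat\phi^*\|=1$ and sign normalizations $\langle\phi,\hat\phi\rangle\ge 0$, $\langle\phi^*,\hat\phi^*\rangle\ge0$.
   Context: $X=\{X_t:t=0,1,2,\dots\}$ is a time-homogeneous, strictly stationary and ergodic first-order Markov process with values in $\mathcal X\subseteq\mathbb R^d$ and stationary distribution $Q$. $m:\mathcal X^2\to(0,\infty)$ is a measurable function. $L^2$ is the space of $\psi:\mathcal X\to\mathbb R$ with $\int\psi^2\,dQ<\infty$, with norm $\|\cdot\|$ and inner product $\langle\cdot,\cdot\rangle$; functions are identified $Q$-a.e., and ''positive'' means positive $Q$-a.e. The operator $\mathbb M\psi(x)=\mathbb E[m(X_t,X_{t+1})\psi(X_{t+1})\mid X_t=x]$ acts on $L^2$; $\mathbb M_\tau=\mathbb M^\tau$; $\mathbb M^*$ is the adjoint, $\mathbb M^*\psi(x)=\mathbb E[m(X_t,X_{t+1})\psi(X_t)\mid X_{t+1}=x]$. $\|\cdot\|$ also denotes the operator norm on $L^2$, the Euclidean norm of vectors and the operator norm (largest singular value) of matrices. An eigenvalue is simple if it has a unique eigenfunction up to scale, and isolated if some neighborhood of it contains no other point of the spectrum. Sieve: for each $k$, $b_{k1},\dots,b_{kk}\in L^2$ are linearly independent, $B_k$ is their linear span, $b^k(x)=(b_{k1}(x),\dots,b_{kk}(x))'$,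 and $\Pi_k:L^2\to B_k$ is the orthogonal projection. The dimension $k=k(n)\to\infty$ as $n\to\infty$. $\mathbf G=\mathbb E[b^k(X_t)b^k(X_t)']$ (nonsingular) and $\mathbf M=\mathbb E[b^k(X_t)m(X_t,X_{t+1})b^k(X_{t+1})']$. $\rho_k$ is the largest real generalized eigenvalue of $(\mathbf M,\mathbf G)$, with eigenvectors $\mathbf M c_k=\rho_k\mathbf G c_k$ and $c_k^{*\prime}\mathbf M=\rho_kc_k^{*\prime}\mathbf G$ (well defined and unique up to scale for all large $k$); $\tilde c_k=\mathbf G^{1/2}c_k$, $\tilde c_k^*=\mathbf G^{1/2}c_k^*$, normalized so that $\|\tilde c_k\|=\|\tilde c_k^*\|=1$. Estimators: from data $X_0,\dots,X_n$, $\widehat{\mathbf G}=\frac1n\sum_{t=0}^{n-1}b^k(X_t)b^k(X_t)'$, and either (Case 1) $\widehat{\mathbf M}=\frac1n\sum_{t=0}^{n-1}b^k(X_t)m(X_t,X_{t+1})b^k(X_{t+1})'$ with $m$ known, or (Case 2) $m(\cdot,\cdot)=m(\cdot,\cdot;\alpha_0)$ and $\widehat{\mathbf M}=\frac1n\sum_{t=0}^{n-1}b^k(X_t)m(X_t,X_{t+1};\hat\alpha)b^k(X_{t+1})'$ with $\hat\alpha$ a first-stage estimator of $\alpha_0$. $\hat\rho$ is the largest real generalized eigenvalue of $(\widehat{\mathbf M},\widehat{\mathbf G})$, with $\widehat{\mathbf M}\hat c=\hat\rho\widehat{\mathbf G}\hat c$, $\hat c^{*\prime}\widehat{\mathbf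 M}=\hat\rho\hat c^{*\prime}\widehat{\mathbf G}$ (well defined with probability approaching one), and $\hat\phi(x)=b^k(x)'\hat c$, $\hat\phi^*(x)=b^k(x)'\hat c^*$. Orthogonalized matrices: $\mathbf M^o=\mathbf G^{-1/2}\mathbf M\mathbf G^{-1/2}$, $\widehat{\mathbf G}^o=\mathbf G^{-1/2}\widehat{\mathbf G}\mathbf G^{-1/2}$, $\widehat{\mathbf M}^o=\mathbf G^{-1/2}\widehat{\mathbf M}\mathbf G^{-1/2}$; $\mathbf I$ is the $k\times k$ identity. Norms and inner products of $\hat\phi,\hat\phi^*$ are those of $L^2$ (i.e. with respect to $Q$, treating the estimated coefficients as fixed). *)

(* Defs.v *)
From mathcomp Require Import all_boot all_order all_algebra.
From mathcomp Require Import all_classical all_reals all_analysis.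

Set Implicit Arguments.
Unset Strict Implicit.
Unset Printing Implicit Defensive.

Import Order.TTheory GRing.Theory Num.Theory.
Import numFieldNormedType.Exports.

Local Open Scope classical_set_scope.
Local Open Scope ring_scope.

Section process.
Context {dO dS : measure_display} {Omega : measurableType dO}
  {S : measurableType dS} {R : realType}.
Variables (P : probability Omega R) (X : nat -> {RV P >-> S}).

Definition sigma_past (t : nat) : set (set Omega) :=
  <<s \bigcup_(i in [set i | (i <= t)%N])
        preimage_set_system [set: Omega] (X i) measurable >>.

(* One transition kernel K, independent of t, gives the law of X_{t+1}
   conditionally on the past up to time t. *)
Definition homogeneous_markov : Prop :=
  exists K : R.-pker S ~> S, forall (t : nat) (E : set Omega) (B : set S),
    sigma_past t E -> measurable B ->
    P (E `&` X t.+1 @^-1` B) = (\int[P]_(w in E) K (X t w) B)%E.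

(* Measurable rectangles determine the finite-dimensional laws. *)
Definition strictly_stationary : Prop :=
  forall (s n : nat) (A : nat -> set S), (forall i, measurable (A i)) ->
    P (\bigcap_(i in `I_n) X (s + i)%N @^-1` A i) =
    P (\bigcap_(i in `I_n) X i @^-1` A i).

Definition path_sigma : set (set (nat -> S)) :=
  <<s [set C | exists i (A : set S),
         measurable A /\ C = [set u : nat -> S | A (u i)]] >>.

Definition ergodic : Prop :=
  forall C : set (nat -> S), path_sigma C ->
    [set u : nat -> S | C (fun i => u i.+1)] = C ->
    P [set w | C (fun i => X i w)] = 0%E \/ P [set w | C (fun i => X i w)] = 1%E.

(* g is a version of z |-> E[Y | Z = z].  The equality is between extended
   reals, so that it forces g \o Z to be integrable. *)
Definition is_cond_exp (Y : Omega -> R) (Z : Omega -> S) (g : S -> R) : Prop :=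
  [/\ P.-integrable [set: Omega] (EFin \o Y),
      measurable_fun [set: S] g &
      forall A : set S, measurable A ->
        (\int[P]_(w in Z @^-1` A) (Y w)%:E =
         \int[P]_(w in Z @^-1` A) (g (Z w))%:E)%E].

End process.

Section stochastic_order.
Context {dO : measure_display} {Omega : measurableType dO} {R : realType}.
Variable P : probability Omega R.

(* Outer probability: the estimators below are not required to be measurable
   functions of w.  It coincides with P on measurable events. *)
Definition outer_prob (E : set Omega) : \bar R :=
  ereal_inf [set P A | A in [set A | measurable A /\ E `<=` A]].

Definition op1 (Y : nat -> Omega -> R) : Prop :=
  forall e : R, 0 < e ->
    outer_prob [set w | (e < `|Y n w|)%R] @[n --> \oo] --> 0%E.

Definition Op (Y : nat -> Omega -> R) (a : nat -> R) : Prop :=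
  forall e : R, 0 < e -> exists C : R,
    \forall n \near \oo, (outer_prob [set w | (C * a n < `|Y n w|)%R] <= e%:E)%E.

End stochastic_order.

(* Elements of L^2(Q) are represented by measurable functions S -> R,
   operators on it by maps T on functions that respect Q-a.e. equality. *)
Section L2.
Context {dS : measure_display} {S : measurableType dS} {R : realType}.
Variable Q : probability S R.
Implicit Types (f g psi : S -> R) (F G : (S -> R) * (S -> R)).
Implicit Types (T : (S -> R) -> (S -> R)).

Definition L2 f : Prop := f \in Lfun Q 2%:E.

Definition L2norm f : R := fine ('N[Q]_2%:E[EFin \o f])%E.

Definition L2inner f g : R := \int[Q]_x (f x * g x).

Definition L2opnorm T : \bar R :=
  ereal_sup [set ('N[Q]_2%:E[EFin \o T psi])%E |
             psi in [set psi | L2 psi /\ L2norm psi <= 1]].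

Definition L2bounded T : Prop :=
  (forall psi, L2 psi -> L2 (T psi)) /\ (L2opnorm T < +oo)%E.

Definition L2adjoint T T' : Prop :=
  forall psi, L2 psi -> L2 (T' psi) /\
    forall chi, L2 chi -> L2inner (T chi) psi = L2inner chi (T' psi).

Definition L2positive f : Prop := {ae Q, forall x, 0 < f x}.

(* The spectrum is that of the complexification of T: the pair F = (F.1, F.2)
   stands for the complex function F.1 + i F.2, and z for z.1 + i z.2. *)
Definition L2C F : Prop := L2 F.1 /\ L2 F.2.

Definition L2Cnorm F : R := Num.sqrt (L2norm F.1 ^+ 2 + L2norm F.2 ^+ 2).

Definition L2Ceq F G : Prop :=
  ae_eq Q [set: S] F.1 G.1 /\ ae_eq Q [set: S] F.2 G.2.

Definition L2Czero : (S -> R) * (S -> R) := (cst 0, cst 0).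

(* (T - z) F *)
Definition Cshift T (z : R * R) F : (S -> R) * (S -> R) :=
  (fun x => T F.1 x - (z.1 * F.1 x - z.2 * F.2 x),
   fun x => T F.2 x - (z.1 * F.2 x + z.2 * F.1 x)).

(* T - z has a bounded two-sided inverse U *)
Definition in_resolvent T (z : R * R) : Prop :=
  exists (U : (S -> R) * (S -> R) -> (S -> R) * (S -> R)) (C : R),
    forall F, L2C F ->
      [/\ L2C (U F), L2Cnorm (U F) <= C * L2Cnorm F,
          L2Ceq (Cshift T z (U F)) F & L2Ceq (U (Cshift T z F)) F].

Definition spectrum T : set (R * R) := [set z | ~ in_resolvent T z].

Definition is_eigenvalue T (z : R * R) : Prop :=
  exists F, [/\ L2C F, ~ L2Ceq F L2Czero & L2Ceq (Cshift T z F) L2Czero].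

Definition is_eigenfun T (r : R) f : Prop :=
  L2 f /\ ae_eq Q [set: S] (T f) (fun x => r * f x).

Definition simple_eigenvalue T (r : R) : Prop :=
  exists f, [/\ is_eigenfun T r f, ~ ae_eq Q [set: S] f (cst 0) &
    forall g, is_eigenfun T r g ->
      exists a : R, ae_eq Q [set: S] g (fun x => a * f x)].

Definition isolated_in_spectrum T (r : R) : Prop :=
  exists2 e : R, 0 < e &
    forall z, spectrum T z -> Num.sqrt ((z.1 - r) ^+ 2 + z.2 ^+ 2) < e ->
      z = (r, 0).

Definition largest_eigenvalue T (r : R) : Prop :=
  is_eigenvalue T (r, 0) /\
  forall z, is_eigenvalue T z -> Num.sqrt (z.1 ^+ 2 + z.2 ^+ 2) <= r.

Record perron_frobenius T T' (rho : R) (phi phis : S -> R) : Prop := {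
  pf_bounded : L2bounded T;
  pf_rho_gt0 : 0 < rho;
  pf_phi_pos : L2positive phi;
  pf_phis_pos : L2positive phis;
  pf_phi : is_eigenfun T rho phi;
  pf_phis : is_eigenfun T' rho phis;
  pf_phi_unique : forall f, L2positive f -> is_eigenfun T rho f ->
    exists a : R, ae_eq Q [set: S] f (fun x => a * phi x);
  pf_phis_unique : forall f, L2positive f -> is_eigenfun T' rho f ->
    exists a : R, ae_eq Q [set: S] f (fun x => a * phis x);
  pf_simple : simple_eigenvalue T rho;
  pf_isolated : isolated_in_spectrum T rho;
  pf_largest : largest_eigenvalue T rho;
  pf_limit : forall a a' : R, 0 < a -> 0 < a' ->
    L2inner (fun x => a * phi x) (fun x => a' * phis x) = 1 ->
    forall psi, L2 psi ->
      {ae Q, forall x, (rho ^- tau * iter tau T psi x) @[tau --> \oo] -->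
        L2inner psi (fun y => a' * phis y) * (a * phi x)} }.

End L2.

Section matrices.
Context {R : realType}.

(* Euclidean and spectral norms; the library's norm on matrices is the sup
   norm. *)
Definition enorm k (v : 'cV[R]_k) : R := Num.sqrt (\sum_i v i ord0 ^+ 2).

Definition mxopnorm k (A : 'M[R]_k) : R :=
  sup [set enorm (A *m v) | v in [set v : 'cV[R]_k | enorm v <= 1]].

Definition is_psd_sqrt k (G H : 'M[R]_k) : Prop :=
  [/\ H^T = H, forall v : 'cV[R]_k, 0 <= (v^T *m H *m v) ord0 ord0 &
      H *m H = G].

(* G^{-1/2} A G^{-1/2}, where H = G^{1/2} *)
Definition orthogonalize k (H A : 'M[R]_k) : 'M[R]_k :=
  invmx H *m A *m invmx H.

Definition gen_eigenvalue k (A G : 'M[R]_k) (r : R) : Prop :=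
  exists2 c : 'cV[R]_k, c != 0 & A *m c = r *: (G *m c).

Definition largest_gen_eigenvalue k (A G : 'M[R]_k) (r : R) : Prop :=
  gen_eigenvalue A G r /\ forall r', gen_eigenvalue A G r' -> r' <= r.

Definition largest_gen_eigen k (A G : 'M[R]_k) (r : R) (c cs : 'cV[R]_k) :
    Prop :=
  [/\ largest_gen_eigenvalue A G r, c != 0, cs != 0,
      A *m c = r *: (G *m c) & cs^T *m A = r *: (cs^T *m G)].

End matrices.

Section sieve.
Context {dS : measure_display} {S : measurableType dS} {R : realType}.
Variable Q : probability S R.
Variables (k : nat) (b : 'I_k -> S -> R).

Definition sieve_fun (v : 'cV[R]_k) : S -> R :=
  fun x => \sum_i v i ord0 * b i x.

Definition L2_lin_indep : Prop :=
  forall v : 'cV[R]_k, ae_eq Q [set: S] (sieve_fun v) (cst 0) -> v = 0.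

Definition sieve_proj (psi : S -> R) : S -> R :=
  xget (cst 0) [set f | (exists v, f = sieve_fun v) /\
    forall v, L2inner Q (fun x => psi x - f x) (sieve_fun v) = 0].

End sieve.

Section sieve_matrices.
Context {dO dS : measure_display} {Omega : measurableType dO}
  {S : measurableType dS} {R : realType}.
Variables (P : probability Omega R) (X : nat -> {RV P >-> S}).
Variables (k : nat) (b : 'I_k -> S -> R).

Definition Gmx : 'M[R]_k :=
  \matrix_(i, j) \int[P]_w (b i (X 0%N w) * b j (X 0%N w)).

Definition Mmx (m : S -> S -> R) : 'M[R]_k :=
  \matrix_(i, j)
    \int[P]_w (b i (X 0%N w) * m (X 0%N w) (X 1%N w) * b j (X 1%N w)).

Definition Ghatmx (n : nat) (w : Omega) : 'M[R]_k :=
  \matrix_(i, j) (n%:R^-1 * \sum_(t < n) b i (X t w) * b j (X t w)).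

Definition Mhatmx (m : S -> S -> R) (n : nat) (w : Omega) : 'M[R]_k :=
  \matrix_(i, j) (n%:R^-1 *
    \sum_(t < n) b i (X t w) * m (X t w) (X t.+1 w) * b j (X t.+1 w)).

End sieve_matrices.

(* Main.v *)
(* Since Pi_k M -> M in operator norm, M is compact. Deflate it: the operator
   D x = M x - <phis, x> phi has no eigenvalue in [rho, oo), so by compactness and
   completeness of L^2 it satisfies |(D - z) x| >= c |x| for all z >= rho - c. This
   bound survives in every matrix A that approximates M on the sieve space, and
   (transposed) in A^T. It yields at once:
   - an eigenvalue of A near rho, by the intermediate value theorem, while every
     eigenvalue of A to the right of rho - c is close to rho;
   - the a posteriori estimates |g - a f| = O(|(A - z) g|) and
     |a (r - z)| = O(|(A - z) g|) for an eigenpair (r, f) of A, and similarly for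
     left eigenvectors.
   Applied to the population matrix with g the coordinates of Pi phi (or Pi phis) and
   z = rho they bound the bias by delta_k; applied to the sample matrix with g the
   population eigenvector they bound the sampling error by eta_{n,k}. *)

(* The sample hypotheses have two strengths: in operator norm the matrices are close only up to
   [o_p(1)], while the rate [eta] concerns a single vector, the population eigenvector. A
   perturbation bound in operator norm would lose that rate. Hence the estimates in terms of the
   residual of one vector, with constants built from [c], [K] and [rho] alone; norm convergence
   merely brings the matrices within a fixed tolerance [d] of the operator. The bias obeys the same
   rule: tested against the sieve, the projection error of the operator cancels, and the residual of
   a projected eigenfunction is at most [K] times its own approximation error. Deflation is there
   because [M - z] is singular at [z = rho]. It sends [phi] to [(rho - <phis, phi>) phi], and
   [<phis, phi> > 0] since both functions are positive, so the eigenvalue moves to the left. The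
   matrix eigenvalue is known only as a maximum over real ones. One eigenvalue near [rho] puts this
   maximum to the right of [rho - c], where the estimates hold for every eigenvalue; neither
   continuity of eigenvalues nor spectral projections enter. *)
Require Import Defs.
From mathcomp Require Import all_boot all_order all_algebra finmap.
From mathcomp Require Import all_classical all_reals all_analysis.
From mathcomp Require Import measurable_realfun ring lra.
Import Order.TTheory GRing.Theory Num.Theory.
Import numFieldNormedType.Exports.

Set Implicit Arguments.
Unset Strict Implicit.
Unset Printing Implicit Defensive.

Local Open Scope classical_set_scope.
Local Open Scope ring_scope.

(** * Semi-inner products *)

(* Elements of L^2 are not quotiented by a.e. equality, so the form is only
   semi-definite and equality of vectors is replaced by [nrm (x - y) = 0]. *)
Record semi_inner (R : realType) (V : lmodType R) := SemiInner {
  ip :> V -> V -> R;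
  ipC : forall x y, ip x y = ip y x;
  ipDl : forall x y z, ip (x + y) z = ip x z + ip y z;
  ipZl : forall a x y, ip (a *: x) y = a * ip x y;
  ip_ge0 : forall x, 0 <= ip x x }.

Section semi_inner_theory.
Context {R : realType} {V : lmodType R} (s : semi_inner V).
Implicit Types (x y z : V) (a : R).

Definition nrm x : R := Num.sqrt (s x x).

Lemma ipDr x y z : s x (y + z) = s x y + s x z.
Proof. by rewrite ipC ipDl !(ipC s _ x). Qed.

Lemma ipZr a x y : s x (a *: y) = a * s x y.
Proof. by rewrite ipC ipZl ipC. Qed.

Lemma ipNl x y : s (- x) y = - s x y.
Proof. by rewrite -scaleN1r ipZl mulN1r. Qed.

Lemma ipNr x y : s x (- y) = - s x y.
Proof. by rewrite ipC ipNl ipC. Qed.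

Lemma ipBl x y z : s (x - y) z = s x z - s y z.
Proof. by rewrite ipDl ipNl. Qed.

Lemma ipBr x y z : s x (y - z) = s x y - s x z.
Proof. by rewrite ipDr ipNr. Qed.

Lemma ip0l x : s 0 x = 0.
Proof. by rewrite -(scale0r 0) ipZl mul0r. Qed.

Lemma ip0r x : s x 0 = 0.
Proof. by rewrite ipC ip0l. Qed.

Lemma nrm_ge0 x : 0 <= nrm x.
Proof. exact: sqrtr_ge0. Qed.

Lemma nrm_sqr x : nrm x ^+ 2 = s x x.
Proof. by rewrite sqr_sqrtr // ip_ge0. Qed.

Lemma nrm0 : nrm 0 = 0.
Proof. by rewrite /nrm ip0l sqrtr0. Qed.

Lemma nrmZ a x : nrm (a *: x) = `|a| * nrm x.
Proof.
by rewrite /nrm ipZl ipZr mulrA -expr2 sqrtrM ?sqr_ge0 // sqrtr_sqr.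
Qed.

Lemma nrmN x : nrm (- x) = nrm x.
Proof. by rewrite -scaleN1r nrmZ normrN1 mul1r. Qed.

Lemma nrmBC x y : nrm (x - y) = nrm (y - x).
Proof. by rewrite -nrmN opprB. Qed.

Lemma ip_sqr_le x y : s x y ^+ 2 <= s x x * s y y.
Proof.
have H t : 0 <= s x x + 2 * t * s x y + t ^+ 2 * s y y.
  have := ip_ge0 s (x + t *: y); rewrite !(ipDl, ipDr) !(ipZl, ipZr) (ipC s y x).
  by move=> h; apply: le_trans h _; rewrite expr2; lra.
have := ip_ge0 s y; rewrite le_eqVlt => /orP[/eqP y0|y0].
  rewrite -y0 mulr0; have [->|xy0] := eqVneq (s x y) 0; first by rewrite expr0n.
  (* When [s y y = 0] the quadratic in [t] is affine; with a nonzero slope it would take the value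
     -1 at this [t]. *)
  have := H (- (s x x + 1) / (2 * s x y)); rewrite -y0 mulr0 addr0.
  have -> : 2 * (- (s x x + 1) / (2 * s x y)) * s x y = - (s x x + 1) by field.
  lra.
have := H (- s x y / s y y).
have -> : s x x + 2 * (- s x y / s y y) * s x y + (- s x y / s y y) ^+ 2 * s y y
   = (s x x * s y y - s x y ^+ 2) / s y y by field; rewrite gt_eqF.
by rewrite pmulr_lge0 ?invr_gt0 // subr_ge0.
Qed.

Lemma cauchy_schwarz x y : `|s x y| <= nrm x * nrm y.
Proof.
rewrite -sqrtr_sqr /nrm -sqrtrM ?ip_ge0 //.
by rewrite ler_wsqrtr // ip_sqr_le.
Qed.

Lemma ip_le x y : s x y <= nrm x * nrm y.
Proof. exact: le_trans (ler_norm _) (cauchy_schwarz _ _). Qed.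

Lemma nrmD x y : nrm (x + y) <= nrm x + nrm y.
Proof.
rewrite -(@ler_pXn2r _ 2) ?nnegrE ?addr_ge0 ?nrm_ge0 //.
rewrite nrm_sqr sqrrD !nrm_sqr ipDl !ipDr (ipC s y x) mulr2n.
by have := ip_le x y; lra.
Qed.

Lemma nrmB x y : nrm (x - y) <= nrm x + nrm y.
Proof. by rewrite (le_trans (nrmD _ _)) // nrmN. Qed.

Lemma nrm_triangle x y z : nrm (x - z) <= nrm (x - y) + nrm (y - z).
Proof. by apply: le_trans (nrmD _ _); rewrite addrA subrK. Qed.

Lemma nrm_ge_sub x y : nrm x - nrm (x - y) <= nrm y.
Proof. by have := nrmD (x - y) y; rewrite subrK; lra. Qed.

Lemma nrm_ext x y : (forall z, s x z = s y z) -> nrm x = nrm y.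
Proof. by move=> H; rewrite /nrm H ipC H. Qed.

Lemma nrm_eq0_ip x y : nrm x = 0 -> s x y = 0.
Proof.
move=> x0; apply/eqP; rewrite -normr_le0.
by rewrite (le_trans (cauchy_schwarz _ _)) // x0 mul0r.
Qed.

Lemma nrm_dual_le x (C : R) :
  0 <= C -> (forall y, s x y <= C * nrm y) -> nrm x <= C.
Proof.
move=> C0 H; have := H x; rewrite -nrm_sqr expr2.
have := nrm_ge0 x; rewrite le_eqVlt => /orP[/eqP <- //|x0].
by rewrite ler_pM2r.
Qed.

(* For unit vectors, |x - y|^2 = 2 - 2<x, y> <= 2 - 2<x, y>^2 = 2 d(x, R y)^2. *)
Lemma unit_nrm_sub_le x y a :
  nrm x = 1 -> nrm y = 1 -> 0 <= s x y -> nrm (x - y) <= 2 * nrm (x - a *: y).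
Proof.
move=> x1 y1 xy0.
have xx : s x x = 1 by rewrite -nrm_sqr x1 expr1n.
have yy : s y y = 1 by rewrite -nrm_sqr y1 expr1n.
have xy1 : s x y <= 1 by have := ip_le x y; rewrite x1 y1 mulr1.
rewrite -(@ler_pXn2r _ 2) ?nnegrE ?mulr_ge0 ?nrm_ge0 //.
rewrite exprMn !nrm_sqr !(ipBl, ipBr) !(ipZl, ipZr) (ipC s y x) xx yy.
by have := sqr_ge0 (s x y - a); nra.
Qed.

Lemma ip_sum_l (I : Type) (r : seq I) (f : I -> V) x :
  s (\sum_(i <- r) f i) x = \sum_(i <- r) s (f i) x.
Proof. by elim/big_rec2: _ => [|i a b _ <-]; rewrite ?ip0l // ipDl. Qed.

End semi_inner_theory.

(* Identities between vectors become ring identities when paired with a test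
   vector. *)
Ltac nrm_ring :=
  apply: nrm_ext => ?; rewrite !(ipBl, ipDl, ipZl, ipNl); ring.

(** * Euclidean space, and matrices that are bounded below *)

Section euclidean.
Context {R : realType} {k : nat}.
Implicit Types (v w : 'cV[R]_k) (A W : 'M[R]_k).

Definition dotv v w : R := \sum_i v i ord0 * w i ord0.

Fact dotvC v w : dotv v w = dotv w v.
Proof. by apply: eq_bigr => i _; rewrite mulrC. Qed.

Fact dotvDl u v w : dotv (u + v) w = dotv u w + dotv v w.
Proof. by rewrite -big_split; apply: eq_bigr => i _; rewrite mxE mulrDl. Qed.

Fact dotvZl a v w : dotv (a *: v) w = a * dotv v w.
Proof. by rewrite mulr_sumr; apply: eq_bigr => i _; rewrite mxE mulrA. Qed.

Fact dotv_ge0 v : 0 <= dotv v v.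
Proof. by apply: sumr_ge0 => i _; rewrite -expr2 sqr_ge0. Qed.

Definition dot : semi_inner 'cV[R]_k := SemiInner dotvC dotvDl dotvZl dotv_ge0.

Lemma enormE v : enorm v = nrm dot v.
Proof. by []. Qed.

Lemma dotE v w : dot v w = (v^T *m w) ord0 ord0.
Proof. by rewrite mxE; apply: eq_bigr => i _; rewrite mxE. Qed.

Lemma dot_mull A v w : dot (A *m v) w = dot v (A^T *m w).
Proof. by rewrite !dotE trmx_mul -mulmxA. Qed.

Lemma nrm_dot_eq0 v : nrm dot v = 0 -> v = 0.
Proof.
move=> /(congr1 (fun x => x ^+ 2)); rewrite nrm_sqr expr0n /= => v0.
apply/colP => i; apply/eqP; rewrite !mxE -sqrf_eq0 expr2; apply/eqP.
by apply: (psumr_eq0P _ v0) => // j _; rewrite -expr2 sqr_ge0.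
Qed.

Lemma nrm_dot_gt0 v : v != 0 -> 0 < nrm dot v.
Proof.
by rewrite lt_def nrm_ge0 andbT; apply: contra => /eqP/nrm_dot_eq0/eqP.
Qed.

Lemma outerE (q p w : 'cV[R]_k) : q *m p^T *m w = dot p w *: q.
Proof.
by rewrite -mulmxA [p^T *m w]mx11_scalar mul_mx_scalar -dotE.
Qed.

Lemma bounded_below_unitmx W c :
  0 < c -> (forall v, c * nrm dot v <= nrm dot (W *m v)) -> W \in unitmx.
Proof.
move=> c0 H; rewrite -unitmx_tr unitmxE unitfE; apply/det0P => -[v v0 vW].
have : nrm dot (W *m v^T) = 0.
  by rewrite -[W]trmxK -trmx_mul vW trmx0 nrm0.
have := H v^T => /[swap] ->; rewrite pmulr_rle0 // leNgt nrm_dot_gt0 //.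
by apply: contra v0 => /eqP v0; rewrite -[v]trmxK v0 trmx0.
Qed.

Lemma bounded_below_inv W c v :
  0 < c -> (forall v, c * nrm dot v <= nrm dot (W *m v)) ->
  nrm dot (invmx W *m v) <= nrm dot v / c.
Proof.
move=> c0 H; have := H (invmx W *m v).
rewrite mulmxA mulmxV ?(bounded_below_unitmx c0 H) // mul1mx.
by rewrite ler_pdivlMr // mulrC.
Qed.

(** In finite dimension a lower bound gives an inverse of norm at most [1 / c], and
    [|v|^2 = <W^-1 v, W^T v>] carries this over to the transpose. *)
Lemma bounded_below_tr W c :
  0 < c -> (forall v, c * nrm dot v <= nrm dot (W *m v)) ->
  forall v, c * nrm dot v <= nrm dot (W^T *m v).
Proof.
move=> c0 H v; have := nrm_ge0 dot v.
rewrite le_eqVlt => /orP[/eqP <-|v0]; first by rewrite mulr0 nrm_ge0.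
rewrite -(ler_pM2r v0) -mulrA -expr2 nrm_sqr.
rewrite -{1}[v]mul1mx -(mulmxV (bounded_below_unitmx c0 H)) -mulmxA dot_mull.
apply: le_trans (ler_wpM2l (ltW c0) (ip_le _ _ _)) _.
rewrite [leRHS]mulrC mulrA ler_wpM2r ?nrm_ge0 // -ler_pdivlMl // mulrC.
exact: bounded_below_inv.
Qed.

(** [mxopnorm] is a real [sup], which dominates its set only once some upper bound is exhibited; the
    sum of the row norms is a crude one. *)
Lemma enorm_mulmx_bounded A :
  has_ubound [set enorm (A *m v) | v in [set v : 'cV[R]_k | enorm v <= 1]].
Proof.
exists (\sum_i nrm dot (row i A)^T) => _ [v v1 <-]; rewrite /enorm.
have coord i : `|(A *m v) i ord0| <= nrm dot (row i A)^T.
  have -> : (A *m v) i ord0 = dot (row i A)^T v.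
    by rewrite mxE; apply: eq_bigr => j _; rewrite !mxE.
  rewrite (le_trans (cauchy_schwarz _ _ _)) //.
  by rewrite ler_piMr // nrm_ge0.
have S0 : 0 <= \sum_i nrm dot (row i A)^T by apply: sumr_ge0 => i _; exact: nrm_ge0.
rewrite -[leRHS]ger0_norm // -sqrtr_sqr ler_wsqrtr // expr2 mulr_suml ler_sum // => i _.
rewrite -real_normK ?num_real // expr2 ler_pM //.
by rewrite (le_trans (coord i)) // (bigD1 i) //= lerDl sumr_ge0 // => j _; exact: nrm_ge0.
Qed.

Lemma enorm_mulmx_le A v : enorm (A *m v) <= mxopnorm A * enorm v.
Proof.
rewrite !enormE; have := nrm_ge0 dot v.
rewrite le_eqVlt => /orP[/eqP v0|v0].
  by rewrite -v0 (nrm_dot_eq0 (esym v0)) mulmx0 nrm0 mulr0.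
rewrite -ler_pdivrMr //; apply: ub_le_sup; first exact: enorm_mulmx_bounded.
exists ((nrm dot v)^-1 *: v) => /=.
  by rewrite enormE nrmZ ger0_norm ?invr_ge0 ?nrm_ge0 // mulVf ?gt_eqF.
by rewrite enormE -scalemxAr nrmZ ger0_norm ?invr_ge0 ?nrm_ge0 // mulrC.
Qed.

End euclidean.

(** * Perturbation of eigenpairs *)

Section galerkin_perturbation.
Context {R : realType} {V : lmodType R} (s : semi_inner V).
Variables (T : V -> V) (K rho c e0 : R) (phi phis : V).
(** A Lipschitz bound stands in for linearity: the operator acts on representatives, so [T (x - y)]
    and [T x - T y] may differ on a null set. *)
Hypothesis T_bound : forall x y, nrm s (T x - T y) <= K * nrm s (x - y).
Hypothesis T_phi : nrm s (T phi - rho *: phi) = 0.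
Hypothesis T_phis : forall x, s phis (T x) = rho * s phis x.
Hypotheses (phi1 : nrm s phi = 1) (phis1 : nrm s phis = 1).
Hypotheses (K_ge0 : 0 <= K) (rho_gt0 : 0 < rho) (c_gt0 : 0 < c) (e0_gt0 : 0 < e0).
(* The rank-one deflation [T - phi <phis, .>] moves the eigenvalue rho away and
   is bounded below at every real point to the right of [rho - e0]. *)
Hypothesis T_low : forall z x, rho - e0 <= z ->
  c * nrm s x <= nrm s (T x - s phis x *: phi - z *: x).

(** [F] is a linear isometry whose range is the sieve space, and [ps] is its adjoint applied to
    [phis]: the coordinates of the projection of [phis]. *)
Variables (k : nat) (F : 'cV[R]_k -> V).
Hypotheses (F_D : forall v w, F (v + w) = F v + F w)
  (F_Z : forall a v, F (a *: v) = a *: F v)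
  (F_ip : forall v w, s (F v) (F w) = dot v w).
Variable (ps : 'cV[R]_k).
Hypothesis ps_ip : forall w, dot ps w = s phis (F w).

Implicit Types (z r eps : R) (f g : 'cV[R]_k).

Lemma F_B v w : F (v - w) = F v - F w.
Proof. by rewrite F_D -[- w]scaleN1r F_Z scaleN1r. Qed.

Lemma F_nrm v : nrm s (F v) = nrm dot v.
Proof. by rewrite /nrm F_ip. Qed.

Lemma ps_le1 : nrm dot ps <= 1.
Proof.
apply: nrm_dual_le => // w; rewrite mul1r ps_ip -F_nrm.
by rewrite (le_trans (ip_le _ _ _)) // phis1 mul1r.
Qed.

Section approximation.
Variables (A : 'M[R]_k) (d : R).
Hypothesis A_T : forall w, nrm s (F (A *m w) - T (F w)) <= d * nrm dot w.
Hypothesis d_ge0 : 0 <= d.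

(** [phis] is an exact left eigenvector of [T], so [ps] is an approximate one of [A]. *)
Lemma ps_mul w : `|dot ps (A *m w) - rho * dot ps w| <= d * nrm dot w.
Proof.
rewrite !ps_ip -T_phis -ipBr (le_trans (cauchy_schwarz _ _ _)) //.
by rewrite phis1 mul1r.
Qed.

Section deflation.
(** [q] is any approximation of [phi]: its projection in the estimates for right eigenvectors, a
    right eigenvector of [A] in those for left ones. *)
Variable q : 'cV[R]_k.
Hypothesis q_phi : nrm s (F q - phi) <= d.
Hypothesis d_c : 4 * d <= c.

(** Replacing [T] by [A] and [phi] by [F q] costs [d * nrm dot w] each, together at most half of
    [c * nrm dot w]. *)
Lemma deflated_low z w : rho - e0 <= z ->
  c / 2 * nrm dot w <= nrm dot ((A - q *m ps^T - z%:M) *m w).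
Proof.
move=> ze; have := T_low (F w) ze; rewrite F_nrm => H.
rewrite !mulmxBl outerE mul_scalar_mx -[leRHS]F_nrm !F_B !F_Z ps_ip.
set a := s phis (F w) in H *.
have aw : `|a| <= nrm dot w.
  by rewrite (le_trans (cauchy_schwarz _ _ _)) // phis1 mul1r F_nrm.
have := nrmB s (F (A *m w) - a *: F q - z *: F w)
  (F (A *m w) - T (F w) - a *: (F q - phi)).
have -> : nrm s (F (A *m w) - a *: F q - z *: F w -
    (F (A *m w) - T (F w) - a *: (F q - phi))) = nrm s (T (F w) - a *: phi - z *: F w).
  by nrm_ring.
have := nrmB s (F (A *m w) - T (F w)) (a *: (F q - phi)); rewrite nrmZ.
have := A_T w; have := ler_wpM2r (nrm_ge0 dot w) d_c.
have := ler_pM (normr_ge0 a) (nrm_ge0 s (F q - phi)) aw q_phi.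
lra.
Qed.

Lemma nrm_q : nrm dot q <= 1 + d.
Proof.
rewrite -F_nrm; have := nrmD s (F q - phi) phi; rewrite subrK phi1.
by have := q_phi; lra.
Qed.

Lemma deflated_unit z : rho - e0 <= z -> A - q *m ps^T - z%:M \in unitmx.
Proof.
move=> ze; apply: (@bounded_below_unitmx _ _ _ (c / 2)); first by rewrite divr_gt0.
by move=> v; exact: deflated_low.
Qed.

(** On an eigenvector the deflated matrix reduces to [- <ps, f> q], whose norm is at most
    [2 |<ps, f>|]; compare with the lower bound [c / 2]. *)
Lemma eigen_ps_lower r f : rho - e0 <= r -> d <= 1 ->
  A *m f = r *: f -> nrm dot f = 1 -> c / 4 <= `|dot ps f|.
Proof.
move=> re d1 Af f1; have := deflated_low f re.
rewrite !mulmxBl outerE mul_scalar_mx Af addrAC subrr add0r nrmN nrmZ f1.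
have := ler_wpM2l (normr_ge0 (dot ps f)) nrm_q.
have := ler_wpM2l (normr_ge0 (dot ps f)) d1; lra.
Qed.

Lemma eigen_near r f : rho - e0 <= r -> d <= 1 ->
  A *m f = r *: f -> nrm dot f = 1 -> `|r - rho| <= 4 / c * d.
Proof.
move=> re d1 Af f1; have := eigen_ps_lower re d1 Af f1; have := ps_mul f.
rewrite Af ipZr -mulrBl normrM f1 mulr1 => h1 h2.
rewrite mulrAC ler_pdivlMr //; have := ler_wpM2l (normr_ge0 (r - rho)) h2; lra.
Qed.

(* Eigenvalues of [A] to the right of [rho - e0] are the zeros of
   [z |-> 1 + <ps, (A - q ps^T - z)^-1 q>], which changes sign near rho. *)
Lemma exists_eigen eps : 0 < eps -> eps <= e0 -> eps < s phis phi -> d <= 1 ->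
  d * (1 + 8 / c) < eps ->
  exists (r : R) (f : 'cV[R]_k), [/\ f != 0, `|r - rho| <= eps & A *m f = r *: f].
Proof.
move=> eps0 epse epsg d1 deps.
(* The deflated matrix is known to be invertible only to the right of [rho - e0]; clipping makes [h]
   Lipschitz on the whole line and changes nothing on the interval searched. *)
pose clip z := Num.max (rho - eps) z.
pose B z := A - q *m ps^T - (clip z)%:M.
have clip_ge z : rho - e0 <= clip z.
  by rewrite /clip le_max; apply/orP; left; lra.
pose x z := invmx (B z) *m q.
pose h z := 1 + dot ps (x z).
have Bx z : B z *m x z = q by rewrite mulmxA mulmxV ?mul1mx // deflated_unit.
have c2 : 0 < c / 2 by rewrite divr_gt0.
have invB z v : nrm dot (invmx (B z) *m v) <= nrm dot v / (c / 2).
  by apply: bounded_below_inv => // w; exact: deflated_low.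
have x_le z : nrm dot (x z) <= 4 / c.
  apply: le_trans (invB _ _) _; have := nrm_q => q1.
  rewrite ler_pdivrMr //.
  have -> : 4 / c * (c / 2) = 2 by field; rewrite gt_eqF.
  lra.
(* Pairing [B z *m x z = q] with [ps]. For the exact operator this reads [h z = (rho - z) / (rho -
   <phis, phi> - z)], which changes sign at [rho]; since [eps < <phis, phi>], the error [eps]
   preserves the signs at [rho - eps] and [rho + eps]. *)
have hE z : `|(rho - s phis phi - clip z) * h z - (rho - clip z)| < eps.
  have e1 := ps_mul (x z); have e2 : `|dot ps q - s phis phi| <= d.
    by rewrite ps_ip -ipBr (le_trans (cauchy_schwarz _ _ _)) // phis1 mul1r.
  have := congr1 (dot ps) (Bx z).
  rewrite !mulmxBl outerE mul_scalar_mx !ipBr !ipZr => e3.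
  have a_le : `|dot ps (x z)| <= 4 / c.
    rewrite (le_trans (cauchy_schwarz _ _ _)) // (le_trans _ (x_le z)) //.
    by rewrite ler_piMl ?nrm_ge0 // ps_le1.
  apply: le_lt_trans deps.
  have -> : (rho - s phis phi - clip z) * h z - (rho - clip z) =
    (dot ps q - s phis phi) * (1 + dot ps (x z)) - (dot ps (A *m x z) - rho * dot ps (x z)).
    by rewrite /h; move: e3; set a := dot ps (x z); set b := dot ps (_ *m _) => e3; lra.
  rewrite (le_trans (ler_normB _ _)) // normrM.
  have a1 : `|1 + dot ps (x z)| <= 1 + 4 / c.
    by rewrite (le_trans (ler_normD _ _)) // normr1 lerD2l.
  have := ler_pM (normr_ge0 _) (normr_ge0 _) e2 a1.
  by have := ler_wpM2l d_ge0 (x_le z); lra.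
have h_lip z z' : `|h z - h z'| <= 8 / c ^+ 2 * `|z - z'|.
  have -> : h z - h z' = dot ps (x z - x z') by rewrite ipBr /h; ring.
  rewrite (le_trans (cauchy_schwarz _ _ _)) //.
  rewrite (le_trans (ler_wpM2r (nrm_ge0 _ _) ps_le1)) // mul1r.
  (* Resolvent identity. *)
  have -> : x z - x z' = (clip z - clip z') *: (invmx (B z) *m x z').
    rewrite scalemxAr -[x z' in LHS]mul1mx -(mulVmx (deflated_unit (clip_ge z))) -mulmxA -mulmxBr.
    congr (_ *m _); rewrite -/(B z) -{1}(Bx z') -mulmxBl.
    by rewrite /B addrC opprB addrA subrK -raddfB mul_scalar_mx.
  rewrite nrmZ mulrC ler_pM ?nrm_ge0 //.
    apply: le_trans (invB _ _) _.
    rewrite ler_pdivrMr // (le_trans (x_le _)) //.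
    by have -> : 8 / c ^+ 2 * (c / 2) = 4 / c by field; rewrite gt_eqF.
  have := ler_norm (z - z'); have := ler_norm (z' - z); rewrite distrC ler_norml /clip.
  rewrite /Num.max; case: ltP => h1; case: ltP => h2 h3 h4; apply/andP; split; lra.
have h_cont : continuous h.
  move=> z; apply/cvgrPdist_le => e e_gt0; near=> t.
  apply: le_trans (h_lip _ _) _; rewrite mulrC -ler_pdivlMr; last first.
    by rewrite divr_gt0 // exprn_gt0.
  near: t; apply: (@cvgr_dist_le _ _ _ _ _ id z) => //.
  by rewrite divr_gt0 // divr_gt0 // exprn_gt0.
have clipm : clip (rho - eps) = rho - eps by rewrite /clip maxxx.
have clipp : clip (rho + eps) = rho + eps by rewrite /clip max_r //; lra.
have hm : h (rho - eps) <= 0.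
  have := hE (rho - eps); rewrite clipm ltr_norml => /andP[h1 h2].
  by rewrite leNgt; apply/negP => h3; nra.
have hp : 0 <= h (rho + eps).
  have := hE (rho + eps); rewrite clipp ltr_norml => /andP[h1 h2].
  by rewrite leNgt; apply/negP => h3; nra.
have [|||z zI hz] := @IVT R h (rho - eps) (rho + eps) 0; first lra.
- exact: continuous_subspaceT.
- by rewrite ge_min hm /= le_max hp orbT.
move: zI; rewrite in_itv /= => /andP[z1 z2].
have clipz : clip z = z by rewrite /clip max_r.
(* With this value the rank-one term contributes exactly [q], which cancels the right-hand side and
   leaves [(A - z) x = 0]. *)
have pq : dot ps (x z) = -1 by move: hz; rewrite /h; lra.
exists z, (x z); split.
- by apply/eqP => x0; move: pq; rewrite x0 ip0r; lra.
- by rewrite ler_norml; lra.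
- have := Bx z; rewrite /B clipz !mulmxBl outerE mul_scalar_mx pq scaleN1r opprK.
  by move=> /eqP; rewrite addrAC -subr_eq0 addrK subr_eq0 => /eqP.
Unshelve. all: by end_near.
Qed.

(** The multiple [a] makes [u = g - a f] orthogonal to [ps], so that on [u] the deflated matrix is
    [A - z] itself. With [t = a (r - z)] and [eta] the residual of [g], the lower bound gives
    [c/2 |u| <= eta + |t|], and pairing with the approximate left eigenvector [ps] gives
    [c/4 |t| <= eta + d |u|]. The condition [16 d <= c^2] lets the two be solved for [|u|] and
    [|t|]. *)
Lemma right_eigen_compare r f g z :
  d <= 1 -> 16 * d <= c ^+ 2 -> rho - e0 <= r -> rho - e0 <= z ->
  A *m f = r *: f -> nrm dot f = 1 ->
  exists a : R,
    nrm dot (g - a *: f) <= (4 / c) * (1 + 4 / c) * nrm dot (A *m g - z *: g) /\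
    `|a * (r - z)| <= (1 + 8 / c) * nrm dot (A *m g - z *: g).
Proof.
move=> d1 d_c2 re ze Af f1; have psf := eigen_ps_lower re d1 Af f1.
have c40 : 0 < c / 4 by rewrite divr_gt0.
have psf0 : dot ps f != 0 by rewrite -normr_gt0 (lt_le_trans c40).
exists (dot ps g / dot ps f); set a := dot ps g / _.
set eta := nrm dot (A *m g - _); have [t tE] : {t | t = a * (r - z)} by exists (a * (r - z)).
have [u uE] : {u | u = g - a *: f} by exists (g - a *: f).
rewrite -tE -uE.
have psu : dot ps u = 0 by rewrite uE ipBr ipZr /a; field.
have Au : A *m u - z *: u = (A *m g - z *: g) - t *: f.
  rewrite uE tE mulmxBr -scalemxAr Af; move: (A *m g) => y.
  by apply/colP => i; rewrite !mxE; ring.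
have t_le : c / 4 * `|t| <= eta + d * nrm dot u.
  rewrite mulrC (le_trans (ler_wpM2l (normr_ge0 t) psf)) // -normrM.
  have -> : t * dot ps f = dot ps (A *m g - z *: g) - (dot ps (A *m u) - rho * dot ps u).
    by move/(congr1 (dot ps)): Au; rewrite !ipBr !ipZr psu; lra.
  rewrite (le_trans (ler_normB _ _)) // lerD ?ps_mul //.
  rewrite (le_trans (cauchy_schwarz _ _ _)) //.
  by rewrite ler_piMl ?nrm_ge0 // ps_le1.
have u_le : c / 2 * nrm dot u <= eta + `|t|.
  have := deflated_low u ze; rewrite !mulmxBl outerE mul_scalar_mx psu scale0r subr0 Au.
  by move=> /le_trans; apply; rewrite (le_trans (nrmB _ _ _)) // nrmZ f1 mulr1.
have eta0 : 0 <= eta := nrm_ge0 _ _.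
have [c1 u0] : 0 < c ^+ 2 /\ 0 <= nrm dot u by rewrite exprn_gt0 // nrm_ge0.
have du := ler_wpM2r u0 d_c2.
have u_le' : nrm dot u <= 4 / c * (1 + 4 / c) * eta.
  have -> : 4 / c * (1 + 4 / c) * eta = (4 * c * eta + 16 * eta) / c ^+ 2.
    by field; rewrite gt_eqF.
  rewrite ler_pdivlMr //; have := ler_wpM2l (ltW c_gt0) u_le.
  rewrite expr2 in du *; lra.
split=> //.
rewrite -(ler_pM2l c40) (le_trans t_le) //.
have := ler_wpM2l (ltW c1) u_le'.
have -> : c ^+ 2 * (4 / c * (1 + 4 / c) * eta) = 4 * c * eta + 16 * eta.
  by field; rewrite gt_eqF.
have -> : c / 4 * ((1 + 8 / c) * eta) = c / 4 * eta + 2 * eta.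
  by field; rewrite gt_eqF.
lra.
Qed.

(* <f, .> here is the pairing with the right eigenvector: transposing the lower
   bound for [A - f ps^T - z] controls [A^T - z] on the orthogonal of [f]. *)
Lemma left_eigen_compare r f fs g z :
  (exists2 a : R, `|a| = 1 & q = a *: f) ->
  rho - e0 <= z -> `|r - z| <= c / 4 ->
  A *m f = r *: f -> A^T *m fs = r *: fs -> nrm dot f = 1 -> nrm dot fs = 1 ->
  exists a : R,
    nrm dot (g - a *: fs) <= (2 / c) * (1 + 4 / c) * nrm dot (A^T *m g - z *: g).
Proof.
move=> [sg sg1 qf] ze rz Af Afs f1 fs1.
have c2 : 0 < c / 2 by rewrite divr_gt0.
have c40 : 0 < c / 4 by rewrite divr_gt0.
have low u : c / 2 * nrm dot u <= nrm dot (A^T *m u - z *: u) + `|dot f u|.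
  have := bounded_below_tr c2 (fun w => deflated_low w ze) u.
  rewrite !linearB /= trmx_mul trmxK tr_scalar_mx !mulmxBl outerE mul_scalar_mx.
  move=> /le_trans; apply; rewrite addrAC (le_trans (nrmB _ _ _)) // lerD2l.
  rewrite nrmZ qf ipZl normrM sg1 mul1r ler_piMr //; exact: ps_le1.
(* Here the pairing is exact, because [f] is a genuine eigenvector of [A]. Together with
   [|r - z| <= c / 4] it keeps [<f, fs>] away from 0. *)
have pair u : dot f (A^T *m u - z *: u) = (r - z) * dot f u.
  by rewrite ipBr ipZr -dot_mull Af ipZl mulrBl.
have ffs : c / 4 <= `|dot f fs|.
  have := low fs; rewrite Afs -scalerBl nrmZ fs1 !mulr1; lra.
have ffs0 : dot f fs != 0 by rewrite -normr_gt0 (lt_le_trans c40).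
exists (dot f g / dot f fs); set a := dot f g / _; set eta := nrm dot (A^T *m g - _).
have fu : dot f (g - a *: fs) = 0 by rewrite ipBr ipZr /a; field.
have := low (g - a *: fs); rewrite fu normr0 addr0.
have -> : A^T *m (g - a *: fs) - z *: (g - a *: fs) =
    (A^T *m g - z *: g) - (a * (r - z)) *: fs.
  rewrite mulmxBr -scalemxAr Afs; move: (A^T *m g) => y.
  by apply/colP => i; rewrite !mxE; ring.
have eta0 : 0 <= eta := nrm_ge0 _ _.
have arz : `|a * (r - z)| <= 4 / c * eta.
  have : `|a * (r - z)| * `|dot f fs| <= eta.
    rewrite -normrM; have -> : a * (r - z) * dot f fs = dot f (A^T *m g - z *: g).
      by rewrite pair /a; field.
    by rewrite (le_trans (cauchy_schwarz _ _ _)) // f1 mul1r.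
  have := ler_wpM2l (normr_ge0 (a * (r - z))) ffs => h1 h2.
  have -> : 4 / c * eta = eta / (c / 4) by field; rewrite gt_eqF.
  by rewrite ler_pdivlMr //; lra.
move=> h; have := nrmB dot (A^T *m g - z *: g) ((a * (r - z)) *: fs).
rewrite nrmZ fs1 mulr1 -/eta => h'.
have -> : 2 / c * (1 + 4 / c) * eta = (eta + 4 / c * eta) / (c / 2).
  by field; rewrite gt_eqF.
by rewrite ler_pdivlMr // mulrC; lra.
Qed.

End deflation.

Lemma phi_residual (q : 'cV[R]_k) : nrm s (F q - phi) <= d -> d <= 1 ->
  nrm dot (A *m q - rho *: q) <= (2 + K + rho) * d.
Proof.
move=> qd d1; rewrite -F_nrm F_B F_Z.
have -> : nrm s (F (A *m q) - rho *: F q) =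
  nrm s (((F (A *m q) - T (F q)) + (T (F q) - T phi)) +
   ((T phi - rho *: phi) - rho *: (F q - phi))) by nrm_ring.
rewrite (le_trans (nrmD _ _ _)) //.
have := nrmD s (F (A *m q) - T (F q)) (T (F q) - T phi).
have := nrmB s (T phi - rho *: phi) (rho *: (F q - phi)).
rewrite nrmZ T_phi (gtr0_norm rho_gt0) => h1 h2.
have := A_T q; have := T_bound (F q) phi.
have := ler_wpM2l K_ge0 qd; have := ler_wpM2l (ltW rho_gt0) qd.
by have := ler_wpM2l d_ge0 (nrm_q qd); have := ler_wpM2l d_ge0 d1; lra.
Qed.

(** Lets a signed eigenvector [a *: f] take the place of [q], as [left_eigen_compare] requires, at
    the price of a tolerance larger by a fixed factor. *)
Lemma right_eigen_phi q r f : nrm s (F q - phi) <= d -> 4 * d <= c ->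
  d <= 1 -> 16 * d <= c ^+ 2 -> rho - e0 <= r ->
  A *m f = r *: f -> nrm dot f = 1 ->
  exists2 a : R, `|a| = 1 & nrm s (F (a *: f) - phi) <=
     2 * ((4 / c) * (1 + 4 / c) * (2 + K + rho) + 1) * d.
Proof.
move=> qd d_c d1 d_c2 re Af f1.
have rhoe : rho - e0 <= rho by rewrite gerBl ltW.
have [a [H _]] := right_eigen_compare qd d_c q d1 d_c2 re rhoe Af f1.
pose sg : R := if 0 <= s phi (F f) then 1 else -1.
have sg1 : `|sg| = 1 by rewrite /sg; case: ifP; rewrite ?normrN1 ?normr1.
have sgsg : sg * sg = 1 by rewrite /sg; case: ifP => _; ring.
exists sg => //; rewrite nrmBC.
have -> : 2 * ((4 / c) * (1 + 4 / c) * (2 + K + rho) + 1) * d =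
  2 * ((4 / c) * (1 + 4 / c) * ((2 + K + rho) * d) + d) by ring.
apply: le_trans (unit_nrm_sub_le (a * sg) phi1 _ _) _.
- by rewrite F_nrm nrmZ sg1 f1 mulr1.
- rewrite F_Z ipZr /sg; case: ifPn; rewrite ?mul1r // -ltNge => /ltW; lra.
rewrite ler_pM2l // F_Z scalerA -mulrA sgsg mulr1.
have -> : nrm s (phi - a *: F f) = nrm s (F (q - a *: f) - (F q - phi)).
  by rewrite F_B F_Z; nrm_ring.
rewrite (le_trans (nrmB _ _ _)) // lerD // F_nrm (le_trans H) //.
by rewrite ler_wpM2l ?phi_residual // mulr_ge0 ?addr_ge0 ?divr_ge0 ?ltW.
Qed.

End approximation.

Section rates.
(** [B] and [B'] are the constants of [right_eigen_compare], [B2] that of [left_eigen_compare], and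
    [D2] the loss of tolerance in [right_eigen_phi]. *)
Let B := 4 / c * (1 + 4 / c).
Let B' := 1 + 8 / c.
Let B2 := 2 / c * (1 + 4 / c).
Let D2 := 2 * (B * (2 + K + rho) + 1).

Hypothesis T_le : forall x, nrm s (T x) <= K * nrm s x.
Variables (d : R) (A0 : 'M[R]_k) (q : 'cV[R]_k).
Hypotheses (d_gt0 : 0 < d) (d_le1 : d <= 1) (d_c : 4 * (D2 * d) <= c)
  (d_c2 : 32 * d <= c ^+ 2) (d_BK : 2 * (1 + B * K) * d <= 1).
Hypothesis q_ip : forall w, dot q w = s phi (F w).
Hypothesis q_phi : nrm s (F q - phi) <= d.
Hypothesis A0_ip : forall v w, dot v (A0 *m w) = s (F v) (T (F w)).
Hypothesis A0_T : forall w, nrm s (F (A0 *m w) - T (F w)) <= d / 2 * nrm dot w.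

Let d_ge0 : 0 <= d := ltW d_gt0.
Let B_ge0 : 0 <= B.
Proof. by rewrite /B mulr_ge0 ?addr_ge0 ?divr_ge0 // ltW. Qed.

Let D2_ge2 : 2 <= D2.
Proof.
rewrite /D2; have : 0 <= B * (2 + K + rho); last by lra.
by rewrite mulr_ge0 // !addr_ge0 // ltW.
Qed.

Let d_D2 : d <= D2 * d.
Proof. by rewrite ler_peMl //; have := D2_ge2; lra. Qed.

Let d_c4 : 4 * d <= c.
Proof. by have := d_D2; have := d_c; lra. Qed.

Let d_c16 : 16 * d <= c ^+ 2.
Proof. by have := d_gt0; have := d_c2; lra. Qed.

Lemma A0_le w : nrm dot (A0 *m w) <= K * nrm dot w.
Proof.
apply: nrm_dual_le => [|v]; first by rewrite mulr_ge0 ?nrm_ge0.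
rewrite ipC A0_ip (le_trans (ip_le _ _ _)) // F_nrm mulrC ler_wpM2r ?nrm_ge0 //.
by rewrite (le_trans (T_le _)) // F_nrm.
Qed.

(** Galerkin orthogonality: against [F w], [A0 *m q] acts as [T (F q)] and [rho *: q] as
    [rho *: phi], that is [T phi]. The error of [A0] as an approximation of [T] drops out; only that
    of [q] remains. *)
Lemma A0_q_residual : nrm dot (A0 *m q - rho *: q) <= K * nrm s (F q - phi).
Proof.
apply: nrm_dual_le => [|w]; first by rewrite mulr_ge0 ?nrm_ge0.
have -> : dot (A0 *m q - rho *: q) w = s (T (F q) - T phi) (F w) + s (T phi - rho *: phi) (F w).
  by rewrite !ipBl !ipZl q_ip (ipC dot) A0_ip (ipC s (F w)); ring.
rewrite (nrm_eq0_ip _ T_phi) addr0 (le_trans (ip_le _ _ _)) // F_nrm.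
by rewrite ler_wpM2r ?nrm_ge0.
Qed.

Lemma A0_ps_residual : nrm dot (A0^T *m ps - rho *: ps) <= K * nrm s (F ps - phis).
Proof.
apply: nrm_dual_le => [|w]; first by rewrite mulr_ge0 ?nrm_ge0.
have -> : dot (A0^T *m ps - rho *: ps) w = s (F ps - phis) (T (F w)).
  by rewrite !ipBl ipZl dot_mull trmxK A0_ip ps_ip T_phis.
rewrite (le_trans (ip_le _ _ _)) // mulrC mulrAC ler_wpM2r ?nrm_ge0 //.
by rewrite (le_trans (T_le _)) // F_nrm.
Qed.

Lemma nrm_q_le1 : nrm dot q <= 1.
Proof.
apply: nrm_dual_le => // w; rewrite mul1r q_ip -F_nrm.
by rewrite (le_trans (ip_le _ _ _)) // phi1 mul1r.
Qed.

Lemma perturbed_T (A : 'M[R]_k) :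
  (forall w, nrm dot (A *m w - A0 *m w) <= d / 2 * nrm dot w) ->
  forall w, nrm s (F (A *m w) - T (F w)) <= d * nrm dot w.
Proof.
move=> AA0 w; rewrite (le_trans (nrm_triangle s _ (F (A0 *m w)) _)) //.
rewrite -F_B F_nrm; have := AA0 w; have := A0_T w; lra.
Qed.

Let A0_Td w : nrm s (F (A0 *m w) - T (F w)) <= d * nrm dot w.
Proof. by apply: perturbed_T => v; rewrite subrr nrm0 mulr_ge0 ?nrm_ge0 // divr_ge0. Qed.

Variables (rk : R) (c0 c0s : 'cV[R]_k).
Hypotheses (rk_ge : rho - e0 <= rk) (A0_c0 : A0 *m c0 = rk *: c0)
  (A0_c0s : A0^T *m c0s = rk *: c0s) (c0_1 : nrm dot c0 = 1) (c0s_1 : nrm dot c0s = 1).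

Let rho_ge : rho - e0 <= rho.
Proof. by rewrite gerBl ltW. Qed.

Lemma right_rate (A : 'M[R]_k) r f h :
  (forall w, nrm dot (A *m w - A0 *m w) <= d / 2 * nrm dot w) ->
  rho - e0 <= r -> A *m f = r *: f -> nrm dot f = 1 ->
  nrm dot ((A - A0) *m c0) <= h -> 2 * B * h <= 1 ->
  `|r - rho| <= 2 * B' * (K + 1) * (nrm s (F q - phi) + h) /\
  (0 <= s phi (F f) -> nrm s (F f - phi) <=
     2 * (1 + B * K) * (1 + B) * (nrm s (F q - phi) + h)).
Proof.
move=> AA0 re Af f1 Ah Bh; have A_T := perturbed_T AA0.
have h0 : 0 <= h := le_trans (nrm_ge0 _ _) Ah.
have BK0 : 0 <= B * K by rewrite mulr_ge0.
have B'0 : 0 <= B' by rewrite /B' addr_ge0 // divr_ge0 // ltW.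
have [a0 [g0 t0]] := right_eigen_compare A0_Td q_phi d_c4 q d_le1 d_c16 rk_ge rho_ge A0_c0 c0_1.
have [a1 [g1 t1]] := right_eigen_compare A_T q_phi d_c4 c0 d_le1 d_c16 re rk_ge Af f1.
have res1 : nrm dot (A *m c0 - rk *: c0) <= h by rewrite -A0_c0 -mulmxBl.
have qd := q_phi; set dl := nrm s (F q - phi) in qd *; have dl0 : 0 <= dl by exact: nrm_ge0.
have {}g0 : nrm dot (q - a0 *: c0) <= B * K * dl.
  by apply: le_trans g0 _; rewrite -[leRHS]mulrA; apply: (ler_wpM2l B_ge0); exact: A0_q_residual.
have {}t0 : `|a0 * (rk - rho)| <= B' * K * dl.
  by apply: le_trans t0 _; rewrite -[leRHS]mulrA; apply: (ler_wpM2l B'0); exact: A0_q_residual.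
have {}g1 : nrm dot (c0 - a1 *: f) <= B * h by apply: le_trans g1 _; exact: (ler_wpM2l B_ge0).
have {}t1 : `|a1 * (r - rk)| <= B' * h by apply: le_trans t1 _; exact: (ler_wpM2l B'0).
have BKd := ler_wpM2l BK0 qd.
have dBK := d_BK; have dle1 := d_le1.
have a0_le : `|a0| <= 1 + B * K.
  have := nrmB dot q (q - a0 *: c0); rewrite opprB addrC subrK nrmZ c0_1 mulr1.
  have := nrm_q_le1; have := ler_wpM2l BK0 dle1; lra.
(* The comparison bounds [a0 * (rk - rho)] only, so [a0] must stay away from 0; this is the purpose
   of [d_BK], and of the bound on [h] for [a1]. *)
have a0_ge : 2^-1 <= `|a0|.
  have := nrm_ge_sub dot q (a0 *: c0); rewrite nrmZ c0_1 mulr1.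
  have := nrmB s (F q) (F q - phi); rewrite opprB addrC subrK phi1 F_nrm -/dl; lra.
have a1_ge : 2^-1 <= `|a1|.
  by have := nrm_ge_sub dot c0 (a1 *: f); rewrite nrmZ c0_1 f1 mulr1; lra.
split.
  have e1 : `|rk - rho| <= 2 * (B' * K * dl).
    by move: t0; rewrite normrM; have := ler_wpM2r (normr_ge0 (rk - rho)) a0_ge; lra.
  have e2 : `|r - rk| <= 2 * (B' * h).
    by move: t1; rewrite normrM; have := ler_wpM2r (normr_ge0 (r - rk)) a1_ge; lra.
  have := ler_normD (r - rk) (rk - rho); rewrite addrA subrK => e3.
  have : 0 <= B' * K * h by rewrite mulr_ge0 // mulr_ge0.
  have : 0 <= B' * dl by rewrite mulr_ge0.
  lra.
move=> sgn; rewrite nrmBC.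
(* For unit vectors with the right sign, distance to the line suffices, so the scale [a0 * a1] need
   not be identified. *)
apply: le_trans (unit_nrm_sub_le (a0 * a1) phi1 _ sgn) _; first by rewrite F_nrm.
rewrite -[leRHS]mulrA -[leRHS]mulrA (ler_pM2l (ltr0Sn _ 1)) mulrA.
have -> : nrm s (phi - (a0 * a1) *: F f) =
  nrm s ((F (q - a0 *: c0) + a0 *: F (c0 - a1 *: f)) - (F q - phi)).
  by rewrite !F_B !F_Z; nrm_ring.
apply: le_trans (nrmB _ _ _) _; rewrite -/dl.
have := nrmD s (F (q - a0 *: c0)) (a0 *: F (c0 - a1 *: f)); rewrite nrmZ !F_nrm.
have := ler_pM (normr_ge0 _) (nrm_ge0 _ _) a0_le g1.
have : 0 <= B * dl by rewrite mulr_ge0.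
have : 0 <= B * K * (B * dl) by rewrite mulr_ge0 // mulr_ge0.
have : 0 <= B * K * h by rewrite mulr_ge0.
lra.
Qed.

Lemma left_rate (A : 'M[R]_k) r f fs h :
  (forall w, nrm dot (A *m w - A0 *m w) <= d / 2 * nrm dot w) ->
  rho - e0 <= r -> A *m f = r *: f -> A^T *m fs = r *: fs ->
  nrm dot f = 1 -> nrm dot fs = 1 ->
  nrm dot ((A^T - A0^T) *m c0s) <= h -> 0 <= s phis (F fs) ->
  nrm s (F fs - phis) <= 2 * (1 + 2 * B2 * K) * (1 + B2) * (nrm s (F ps - phis) + h).
Proof.
move=> AA0 re Af Afs f1 fs1 Ah sgn; have A_T := perturbed_T AA0.
have h0 : 0 <= h := le_trans (nrm_ge0 _ _) Ah.
have B20 : 0 <= B2 by rewrite /B2 mulr_ge0 ?addr_ge0 ?divr_ge0 // ltW.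
have near0 := eigen_near A0_Td q_phi d_c4 rk_ge d_le1 A0_c0 c0_1.
have near1 := eigen_near A_T q_phi d_c4 re d_le1 Af f1.
(* Both eigenvalues then lie within [c / 8] of [rho], hence within [c / 4] of each other. *)
have dc : 4 / c * d <= c / 8.
  rewrite mulrAC ler_pdivrMr //; have := d_c2; rewrite expr2; lra.
have rk_near : `|rk - rho| <= c / 4 by have := c_gt0; lra.
have r_near : `|r - rk| <= c / 4.
  by have := ler_normB (r - rho) (rk - rho); rewrite opprB addrA subrK; lra.
(* The role of [q] passes to right eigenvectors, which are only [D2 * d]-close to [phi]; the whole
   deflation is redone with this tolerance. *)
have up (A' : 'M[R]_k) : (forall w, nrm s (F (A' *m w) - T (F w)) <= d * nrm dot w) ->
    forall w, nrm s (F (A' *m w) - T (F w)) <= D2 * d * nrm dot w.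
  by move=> H w; rewrite (le_trans (H w)) // ler_wpM2r ?nrm_ge0.
have [s0 s0_1 n0] := right_eigen_phi A0_Td d_ge0 q_phi d_c4 d_le1 d_c16 rk_ge A0_c0 c0_1.
have [s1 s1_1 n1] := right_eigen_phi A_T d_ge0 q_phi d_c4 d_le1 d_c16 re Af f1.
have q0 : exists2 a : R, `|a| = 1 & s0 *: c0 = a *: c0 by exists s0.
have q1 : exists2 a : R, `|a| = 1 & s1 *: f = a *: f by exists s1.
have [a0 g0] := left_eigen_compare (up _ A0_Td) n0 d_c ps q0 rho_ge rk_near A0_c0 A0_c0s c0_1 c0s_1.
have [a1 g1] := left_eigen_compare (up _ A_T) n1 d_c c0s q1 rk_ge r_near Af Afs f1 fs1.
set dl := nrm s (F ps - phis); have dl0 : 0 <= dl by exact: nrm_ge0.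
have {}g0 : nrm dot (ps - a0 *: c0s) <= B2 * K * dl.
  by apply: le_trans g0 _; rewrite -[leRHS]mulrA; apply: (ler_wpM2l B20); exact: A0_ps_residual.
have {}g1 : nrm dot (c0s - a1 *: fs) <= B2 * h.
  by apply: le_trans g1 _; apply: (ler_wpM2l B20); rewrite -A0_c0s -mulmxBl.
have dl2 : dl <= 2.
  have := nrmB s (F ps) phis; rewrite -/dl F_nrm phis1; have := ps_le1; lra.
have BK0 : 0 <= B2 * K by rewrite mulr_ge0.
have a0_le : `|a0| <= 1 + 2 * B2 * K.
  have := nrmB dot ps (ps - a0 *: c0s); rewrite opprB addrC subrK nrmZ c0s_1 mulr1.
  have := ps_le1; have := ler_wpM2l BK0 dl2; lra.
rewrite nrmBC; apply: le_trans (unit_nrm_sub_le (a0 * a1) phis1 _ sgn) _.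
  by rewrite F_nrm.
rewrite -[leRHS]mulrA -[leRHS]mulrA (ler_pM2l (ltr0Sn _ 1)) mulrA.
have -> : nrm s (phis - (a0 * a1) *: F fs) =
  nrm s ((F (ps - a0 *: c0s) + a0 *: F (c0s - a1 *: fs)) - (F ps - phis)).
  by rewrite !F_B !F_Z; nrm_ring.
apply: le_trans (nrmB _ _ _) _; rewrite -/dl.
have := nrmD s (F (ps - a0 *: c0s)) (a0 *: F (c0s - a1 *: fs)); rewrite nrmZ !F_nrm.
have := ler_pM (normr_ge0 _) (nrm_ge0 _ _) a0_le g1.
have : 0 <= B2 * dl by rewrite mulr_ge0.
have : 0 <= B2 * K * dl by rewrite mulr_ge0.
have : 0 <= B2 * K * (B2 * dl) by rewrite mulr_ge0 // mulr_ge0.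
have : 0 <= B2 * K * h by rewrite mulr_ge0.
lra.
Qed.

End rates.
End galerkin_perturbation.

(** * Compactness *)

Lemma nrm_dot_le_coord {R : realType} (k : nat) (v : 'cV[R]_k) (t : R) :
  (forall i, `|v i ord0| <= t) -> nrm dot v <= k%:R * t.
Proof.
case: k v => [|k] v vt; first by rewrite /nrm /= /dotv big_ord0 sqrtr0 mul0r.
have t0 : 0 <= t := le_trans (normr_ge0 _) (vt ord0).
rewrite -(@ler_pXn2r _ 2) ?nnegrE ?mulr_ge0 ?nrm_ge0 // nrm_sqr.
have : dot v v <= \sum_(i < k.+1) t ^+ 2.
  by apply: ler_sum => i _; rewrite -expr2 -real_normK ?num_real // ler_pXn2r ?nnegrE.
rewrite sumr_const card_ord => /le_trans; apply.
rewrite exprMn -[leLHS]mulr_natl ler_wpM2r ?sqr_ge0 // expr2 ler_peMr //.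
by rewrite ler1n.
Qed.

Lemma fmap_ultra (I J : Type) (G : set_system I) (f : I -> J) :
  UltraFilter G -> UltraFilter (fmap f G).
Proof.
move=> UG; split=> [|H PH GH]; first exact: fmap_proper_filter.
apply/seteqP; split=> // A HA.
have [//|nA] := in_ultra_setVsetC (f @^-1` A) UG.
have HnA : H (~` A) by exact: GH.
by have [x []] := filter_ex (filterI HA HnA).
Qed.

Lemma ultra_bounded_cvg {R : realType} (I : Type) (G : set_system I) (f : I -> R) (C : R) :
  UltraFilter G -> (forall i, `|f i| <= C) -> exists l : R, f @ G --> l.
Proof.
move=> UG fC; have := @segment_compact R (- C) C; rewrite compact_ultra.
move=> /(_ (f @ G) (fmap_ultra f UG)) [|l [_ fl]]; last by exists l.
by apply: (@filterE _ G) => i /=; rewrite in_itv /= -ler_norml.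
Qed.

Section adjoint.
Context {R : realType} {V : lmodType R} (s : semi_inner V).
Variables (T T' : V -> V) (K : R).
Hypothesis T_adj : forall x y, s (T x) y = s x (T' y).
Hypothesis T_le : forall x, nrm s (T x) <= K * nrm s x.

(** The adjoint makes [T x - T y] and [T (x - y)] indistinguishable under pairing, hence equal in
    norm of difference. *)
Lemma adjoint_bound x y : nrm s (T x - T y) <= K * nrm s (x - y).
Proof.
rewrite (le_trans _ (T_le _)) // le_eqVlt; apply/orP; left; apply/eqP.
by apply: nrm_ext => z; rewrite ipBl !T_adj ipBl.
Qed.

End adjoint.

Section compact_deflation.
Context {R : realType} {V : lmodType R} (s : semi_inner V).
Variables (T T' : V -> V) (K rho : R) (phi phis : V).
Hypothesis T_adj : forall x y, s (T x) y = s x (T' y).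
Hypothesis T_le : forall x, nrm s (T x) <= K * nrm s x.
Hypothesis T_phis : forall x, s phis (T x) = rho * s phis x.
Hypotheses (K_ge0 : 0 <= K) (rho_gt0 : 0 < rho) (phi_phis : 0 < s phis phi).
Hypothesis eig_le : forall z x, nrm s (T x - z *: x) = 0 -> nrm s x != 0 -> z <= rho.
Hypothesis eig_simple : forall x, nrm s (T x - rho *: x) = 0 ->
  exists a : R, nrm s (x - a *: phi) = 0.
Hypothesis complete : forall u : nat -> V,
  (forall e : R, 0 < e -> exists N, forall i j, (N <= i)%N -> (N <= j)%N ->
     nrm s (u i - u j) <= e) ->
  exists g, forall e : R, 0 < e -> exists N, forall i, (N <= i)%N -> nrm s (u i - g) <= e.
Hypothesis T_fin : forall e : R, 0 < e ->
  exists (k : nat) (F : 'cV[R]_k -> V) (p : V -> 'cV[R]_k) (C : R),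
  [/\ forall v w, nrm s (F v - F w) = nrm dot (v - w),
      forall x, nrm s x <= 1 -> nrm dot (p x) <= C &
      forall x, nrm s x <= 1 -> nrm s (F (p x) - T x) <= e].

(* [T] is a norm limit of finite rank operators; along an ultrafilter the finitely
   many bounded coordinates converge, so no subsequence has to be extracted. *)
Lemma ultra_totally_bounded (G : set_system nat) (u : nat -> V) (e : R) :
  UltraFilter G -> (forall j, nrm s (u j) <= 1) -> 0 < e ->
  exists y, \forall j \near G, nrm s (T (u j) - y) <= e.
Proof.
move=> UG u1 e0; have e2 : 0 < e / 2 by rewrite divr_gt0.
have [k [F [p [C [Fiso pC FT]]]]] := T_fin e2.
have coord i : exists l : R, (fun j => p (u j) i ord0) @ G --> l.
  apply: (@ultra_bounded_cvg _ _ _ _ C) => j; rewrite (le_trans _ (pC _ (u1 j))) //.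
  rewrite -sqrtr_sqr ler_wsqrtr // expr2 /= /dotv (bigD1 i) //= lerDl sumr_ge0 // => i' _.
  by rewrite -expr2 sqr_ge0.
have [l lP] := choice coord.
(* The successor avoids a division by zero when [k = 0]; what is needed is [k t <= e / 2]. *)
exists (F (\col_i l i)); pose t := e / 2 / k.+1%:R.
have t0 : 0 < t by rewrite divr_gt0.
have : \forall j \near G, forall i, `|l i - p (u j) i ord0| <= t.
  apply: filter_forall => i; exact: (cvgr_dist_le _ _ (lP i)).
apply: filterS => j jP.
rewrite (le_trans (nrm_triangle _ _ (F (p (u j))) _)) // [e]splitr.
rewrite lerD // ?Fiso.
  by rewrite nrmBC; exact: FT.
rewrite (@le_trans _ _ (k%:R * t)) //.
  by apply: nrm_dot_le_coord => i; rewrite !mxE distrC.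
by rewrite /t mulrCA ler_piMr ?(ltW e2) // ler_pdivrMr // mul1r ler_nat.
Qed.

Let D x := T x - s phis x *: phi.
Let KD := K + nrm s phis * nrm s phi.

Lemma deflation_le x : nrm s (D x) <= KD * nrm s x.
Proof.
rewrite /D (le_trans (nrmB _ _ _)) // /KD mulrDl lerD //.
by rewrite nrmZ mulrAC ler_wpM2r ?nrm_ge0 // cauchy_schwarz.
Qed.

Lemma deflation_bound x y : nrm s (D x - D y) <= KD * nrm s (x - y).
Proof.
rewrite (le_trans _ (deflation_le _)) // le_eqVlt; apply/orP; left; apply/eqP.
apply: nrm_ext => z; rewrite /D !(ipBl, ipZl, ipBr) !T_adj ipBl; ring.
Qed.

Lemma deflation_scale a x : nrm s (D (a *: x) - a *: D x) = 0.
Proof.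
rewrite -(nrm0 s); apply: nrm_ext => z.
rewrite /D !(ipBl, ipZl, ipZr) !T_adj ipZl ip0l; ring.
Qed.

(** Pairing with [phis] gives [(rho - z - <phis, phi>) <phis, w> = 0] with a negative factor. So
    [<phis, w> = 0] and [w] is an eigenvector of [T]; maximality and simplicity of [rho] make it a
    multiple of [phi], which [<phis, phi> > 0] forces to vanish. *)
Lemma deflation_no_eigen z w : rho <= z -> nrm s (D w - z *: w) = 0 -> nrm s w = 0.
Proof.
move=> rz Dw; have := nrm_eq0_ip phis Dw.
rewrite ipC /D !(ipBr, ipZr) T_phis => h.
have pw : s phis w = 0.
  apply/eqP; have : s phis w * (rho - z - s phis phi) = 0 by lra.
  move/eqP; rewrite mulf_eq0 => /orP[//|]; have := phi_phis; lra.
move: Dw; rewrite /D pw scale0r subr0 => Tw.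
apply/eqP/negP => /negP w0; have zr : z = rho by apply/le_anti; rewrite rz (eig_le Tw).
rewrite zr in Tw; have [a wa] := eig_simple Tw.
have := nrm_eq0_ip phis wa; rewrite ipC ipBr ipZr pw sub0r => /eqP.
rewrite oppr_eq0 mulf_eq0 (gt_eqF phi_phis) orbF => /eqP a0.
by move: wa; rewrite a0 scale0r subr0 => /eqP; apply/negP.
Qed.

(** Otherwise there are unit vectors [x j] and [z j >= rho] with [D (x j) - z j *: x j] tending to
    0. The [z j] are bounded, and compactness yields a limit eigenvector of [D], nonzero because the
    limit of [z j] is at least [rho > 0]. *)
Lemma deflation_low_right : exists2 c : R, 0 < c &
  forall z x, rho <= z -> c * nrm s x <= nrm s (D x - z *: x).
Proof.
apply: contrapT => /forall2NP H.
have KD0 : 0 <= KD by rewrite /KD addr_ge0 // mulr_ge0 ?nrm_ge0.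
have {}H (j : nat) : exists zx : R * V,
    [/\ rho <= zx.1, nrm s zx.2 = 1 & nrm s (D zx.2 - zx.1 *: zx.2) <= j.+1%:R^-1].
  case: (H j.+1%:R^-1) => [|/existsNP[z /existsNP[x /not_implyP[rz]]]].
    by move/negP; rewrite -leNgt leNgt invr_gt0 ltr0Sn.
  move/negP; rewrite -ltNge => lt; have x0 : 0 < nrm s x.
    rewrite lt_def nrm_ge0 andbT; apply/eqP => x0; move: lt.
    by rewrite x0 mulr0 ltNge nrm_ge0.
  exists (z, (nrm s x)^-1 *: x); split=> //=.
    by rewrite nrmZ gtr0_norm ?invr_gt0 // mulVf // gt_eqF.
  rewrite -(ler_pM2l x0) -{1}(gtr0_norm x0) -nrmZ.
  have -> : nrm s (nrm s x *: (D ((nrm s x)^-1 *: x) - z *: ((nrm s x)^-1 *: x))) =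
      nrm s (D x - z *: x).
    apply: nrm_ext => y; rewrite /D !(ipBl, ipZl, ipZr) !T_adj !ipZl.
    by field; rewrite gt_eqF.
  by rewrite mulrC ltW.
have [zx zxP] := choice H; pose z j := (zx j).1; pose x j := (zx j).2.
have rz j : rho <= z j by case: (zxP j).
have x1 j : nrm s (x j) = 1 by case: (zxP j).
have Dx j : nrm s (D (x j) - z j *: x j) <= j.+1%:R^-1 by case: (zxP j).
have z_gt0 j : 0 < z j := lt_le_trans rho_gt0 (rz j).
have z_le j : `|z j| <= KD + 1.
  have := nrmB s (D (x j)) (D (x j) - z j *: x j).
  rewrite opprB addrC subrK nrmZ x1 mulr1 => /le_trans; apply.
  rewrite lerD //; first by have := deflation_le (x j); rewrite x1 mulr1.
  by rewrite (le_trans (Dx j)) // invf_le1 ?ler1n.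
have a_le j : `|s phis (x j)| <= nrm s phis.
  by rewrite (le_trans (cauchy_schwarz _ _ _)) // x1 mulr1.
have [G [UG ooG]] := ultraFilterLemma eventually_filter.
have [zl zlP] := ultra_bounded_cvg UG z_le.
have [a aP] := ultra_bounded_cvg UG a_le.
have rzl : rho <= zl.
  by apply: (closed_cvg _ (@closed_ge R rho) _ _ zlP); apply: filterE => j /=.
have zl0 := lt_le_trans rho_gt0 rzl.
have tot (m : nat) : exists y, \forall j \near G, nrm s (T (x j) - y) <= m.+1%:R^-1.
  by apply: ultra_totally_bounded => // j; rewrite x1.
have [y yP] := choice tot.
have small (e : R) : 0 < e -> exists N, forall m, (N <= m)%N -> m.+1%:R^-1 <= e.
  move=> e0; have [N _ NP] := near_infty_natSinv_lt (PosNum e0).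
  by exists N => m Nm; rewrite ltW // NP.
(* Two of the centers [y i], [y j] are close to a common [T (x t)], so the centers form a Cauchy
   sequence. *)
have [yl ylP] : exists g, forall e : R, 0 < e ->
    exists N, forall i, (N <= i)%N -> nrm s (y i - g) <= e.
  apply: complete => e e0; have [N NP] := small (e / 2) (divr_gt0 e0 (ltr0Sn _ _)).
  exists N => i j Ni Nj.
  have [t [ti tj]] := filter_ex (filterI (yP i) (yP j)).
  rewrite (le_trans (nrm_triangle s _ (T (x t)) _)) // [e]splitr lerD //.
    by rewrite nrmBC (le_trans ti) // NP.
  by rewrite (le_trans tj) // NP.
have Ty e : 0 < e -> \forall j \near G, nrm s (T (x j) - yl) <= e.
  move=> e0; have e2 : 0 < e / 2 by rewrite divr_gt0.
  have [N NP] := small _ e2; have [M MP] := ylP _ e2.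
  have := yP (maxn N M); apply: filterS => j jP.
  rewrite (le_trans (nrm_triangle s _ (y (maxn N M)) _)) // [e]splitr lerD //.
    by rewrite (le_trans jP) // NP // leq_maxl.
  by rewrite MP // leq_maxr.
(* [z j *: x j] is close to [D (x j)], hence to [w]: this candidate eigenvector is the limit of
   [zl *: x j] along [G]. *)
pose w := yl - a *: phi.
have main e : 0 < e -> exists j,
    [/\ nrm s (zl *: x j - w) <= e, nrm s (D (x j) - z j *: x j) <= e & `|z j - zl| <= e].
  move=> e0; pose e' := e / (3 + nrm s phi).
  have p3 : 0 < 3 + nrm s phi by rewrite ltr_wpDr ?nrm_ge0.
  have e'0 : 0 < e' by rewrite divr_gt0.
  have e'e : e' * (3 + nrm s phi) = e by rewrite /e' mulfVK // gt_eqF.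
  have [N NP] := small _ e'0.
  have nN : \forall j \near G, (N <= j)%N by apply: ooG; exists N.
  have n1 : \forall j \near G, `|zl - z j| <= e' by exact: (cvgr_dist_le _ _ zlP).
  have n2 : \forall j \near G, `|a - s phis (x j)| <= e' by exact: (cvgr_dist_le _ _ aP).
  have [j [[[j1 j2] j3] j4]] := filter_ex (filterI (filterI (filterI nN n1) n2) (Ty _ e'0)).
  have j5 := le_trans (Dx j) (NP _ j1).
  have e'le : e' <= e by have := nrm_ge0 s phi; nra.
  exists j; split; [|exact: le_trans e'le|by rewrite distrC (le_trans j2)].
  have -> : nrm s (zl *: x j - w) = nrm s ((T (x j) - yl) + (a - s phis (x j)) *: phi
     + (zl - z j) *: x j - (D (x j) - z j *: x j)) by rewrite /w /D; nrm_ring.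
  rewrite (le_trans (nrmB _ _ _)) // -e'e.
  have := nrmD s (T (x j) - yl + (a - s phis (x j)) *: phi) ((zl - z j) *: x j).
  have := nrmD s (T (x j) - yl) ((a - s phis (x j)) *: phi).
  rewrite !nrmZ x1.
  have := ler_wpM2r (nrm_ge0 s phi) j3.
  lra.
have Dw : nrm s (D w - zl *: w) = 0.
  apply/eqP; rewrite eq_le nrm_ge0 andbT; apply/ler_addgt0Pl => e e0; rewrite addr0.
  pose e' := e / (KD + 3 * zl).
  have p3 : 0 < KD + 3 * zl by rewrite ltr_wpDl // mulr_gt0.
  have e'0 : 0 < e' by rewrite divr_gt0.
  have e'e : e' * (KD + 3 * zl) = e by rewrite /e' mulfVK // gt_eqF.
  have [j [j1 j2 j3]] := main _ e'0.
  have -> : nrm s (D w - zl *: w) = nrm s ((D w - D (zl *: x j)) +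
     (D (zl *: x j) - zl *: D (x j)) + zl *: (D (x j) - z j *: x j) +
     zl *: ((z j - zl) *: x j + (zl *: x j - w))) by nrm_ring.
  rewrite (le_trans (nrmD _ _ _)) // nrmZ.
  have := nrmD s (D w - D (zl *: x j) + (D (zl *: x j) - zl *: D (x j)))
    (zl *: (D (x j) - z j *: x j)).
  have := nrmD s (D w - D (zl *: x j)) (D (zl *: x j) - zl *: D (x j)).
  have := nrmD s ((z j - zl) *: x j) (zl *: x j - w).
  rewrite !nrmZ deflation_scale x1 (gtr0_norm zl0) => h1 h2 h3.
  have := deflation_bound w (zl *: x j); rewrite (nrmBC s w) => h4.
  have h5 := ler_wpM2l KD0 j1.
  have h6 := ler_wpM2l (ltW zl0) j2.
  have h7 := ler_wpM2l (ltW zl0) (le_trans h1 (lerD (ler_pM (normr_ge0 _) ler01 j3 (lexx _)) j1)).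
  lra.
have w0 := deflation_no_eigen rzl Dw.
have [j [j1 _ _]] := main (zl / 2) (divr_gt0 zl0 (ltr0Sn _ _)).
have := nrmB s (zl *: x j - w) (- w); rewrite opprK subrK nrmN w0 nrmZ x1.
by rewrite (gtr0_norm zl0); lra.
Qed.

(** Moving [z] left of [rho] by at most half the constant costs at most half the bound; one number
    serves as margin and as lower bound. *)
Lemma deflation_low : exists2 c : R, 0 < c &
  forall z x, rho - c <= z -> c * nrm s x <= nrm s (T x - s phis x *: phi - z *: x).
Proof.
have [c c0 H] := deflation_low_right; exists (c / 2); first by rewrite divr_gt0.
move=> z x rz; have [zr|/ltW rz'] := leP rho z.
  by apply: le_trans (H _ x zr); rewrite ler_wpM2r ?nrm_ge0 //; lra.
have := H rho x (lexx _); have := nrmB s (T x - s phis x *: phi - z *: x) ((rho - z) *: x).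
have -> : nrm s (T x - s phis x *: phi - z *: x - (rho - z) *: x) = nrm s (D x - rho *: x).
  by rewrite /D; nrm_ring.
rewrite nrmZ ger0_norm ?subr_ge0 //.
have : (rho - z) * nrm s x <= c / 2 * nrm s x by rewrite ler_wpM2r ?nrm_ge0 //; lra.
lra.
Qed.

End compact_deflation.

(** * The space L2 *)

Section L2_space.
Context {d : measure_display} {S : measurableType d} {R : realType}.
Variable Q : probability S R.

Fact two_ge1 : (1 <= (2%:E : \bar R))%E. Proof. by rewrite lee_fin ler1n. Qed.

Local Notation V := (LfunType Q two_ge1).

Lemma L2P (f : V) : L2 Q f. Proof. exact: LfunP. Qed.

Lemma L2_measurable (f : S -> R) : L2 Q f -> measurable_fun [set: S] f.
Proof. by move=> /sub_Lfun_mfun; rewrite inE. Qed.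

Lemma L2_intro (f : S -> R) : measurable_fun [set: S] f ->
  ('N[Q]_2%:E[EFin \o f] < +oo)%E -> L2 Q f.
Proof.
by move=> mf fy; rewrite /L2 inE /=; apply/andP; split; rewrite inE.
Qed.

Lemma L2_integrableM (f g : S -> R) : L2 Q f -> L2 Q g ->
  Q.-integrable [set: S] (fun x => (f x * g x)%:E).
Proof. by move=> fL gL; have /Lfun1_integrable := Lfun2_mul_Lfun1 fL gL. Qed.

Lemma EFin_L2inner (f g : S -> R) : L2 Q f -> L2 Q g ->
  (L2inner Q f g)%:E = (\int[Q]_x (f x * g x)%:E)%E.
Proof.
move=> fL gL; rewrite /L2inner /Rintegral fineK //.
by apply: integrable_fin_num => //; exact: L2_integrableM.
Qed.

Fact L2ipC (f g : V) : L2inner Q f g = L2inner Q g f.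
Proof. by apply: eq_Rintegral => x _; rewrite mulrC. Qed.

Fact L2ipDl (f g h : V) : L2inner Q (f + g) h = L2inner Q f h + L2inner Q g h.
Proof.
rewrite /L2inner -RintegralD //; try exact: L2_integrableM (L2P _) (L2P _).
by apply: eq_Rintegral => x _; rewrite -mulrDl.
Qed.

Fact L2ipZl (a : R) (f g : V) : L2inner Q (a *: f) g = a * L2inner Q f g.
Proof.
rewrite /L2inner -RintegralZl //; last exact: L2_integrableM (L2P _) (L2P _).
by apply: eq_Rintegral => x _; rewrite mulrA.
Qed.

Fact L2ip_ge0 (f : V) : 0 <= L2inner Q f f.
Proof. by apply: Rintegral_ge0 => x _; rewrite -expr2 sqr_ge0. Qed.

Definition L2ip : semi_inner V :=
  @SemiInner R V (fun f g => L2inner Q f g) L2ipC L2ipDl L2ipZl L2ip_ge0.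

Lemma Lnorm2_sqr (f : S -> R) :
  (('N[Q]_2%:E[EFin \o f]) `^ 2 = \int[Q]_x (f x ^+ 2)%:E)%E.
Proof.
rewrite poweR_Lnorm //; apply: eq_integral => x _ /=.
by rewrite powR_mulrn // real_normK ?num_real.
Qed.

Lemma L2_Lnorm_fin (f : S -> R) : L2 Q f -> 'N[Q]_2%:E[EFin \o f]%E \is a fin_num.
Proof.
move=> fL; have := sub_Lfun_finLfun fL; rewrite inE /= /finite_norm => h.
by rewrite ge0_fin_numE ?Lnorm_ge0.
Qed.

Lemma L2normE (f : S -> R) : L2 Q f -> L2norm Q f = Num.sqrt (L2inner Q f f).
Proof.
move=> fL; have fin := L2_Lnorm_fin fL.
have n0 : 0 <= L2norm Q f by rewrite /L2norm fine_ge0 // Lnorm_ge0.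
rewrite -[LHS](ger0_norm n0) -sqrtr_sqr; congr Num.sqrt.
rewrite /L2inner /Rintegral.
have -> : (\int[Q]_x (f x * f x)%:E = 'N[Q]_2%:E[EFin \o f] `^ 2)%E.
  by rewrite Lnorm2_sqr; apply: eq_integral => x _; rewrite expr2.
by rewrite -(fineK fin) poweR_EFin powR_mulrn.
Qed.

Lemma L2norm_nrm (f : V) : L2norm Q f = nrm L2ip f.
Proof. exact: L2normE (L2P f). Qed.

Lemma nrm0_ae (f : V) : nrm L2ip f = 0 <-> ae_eq Q [set: S] f (cst 0).
Proof.
split=> [f0|f0].
  have := fine_Lnormr_eq0 (f := f); rewrite -[nm in nm = 0]/(L2norm Q f) L2norm_nrm f0.
  move=> /(_ erefl); apply: filterS => x /= fx _; exact: fx.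
rewrite /nrm; suff -> : L2ip f f = 0 by rewrite sqrtr0.
rewrite /= /L2inner /Rintegral.
rewrite (@ae_eq_integral _ _ _ Q [set: S] (cst 0%E)) ?integral0 //.
- by have /integrableP[] := L2_integrableM (L2P f) (L2P f).
- by apply: filterS f0 => x /= fx _; rewrite fx // mulr0.
Qed.

Lemma nrmB0_ae (f g : V) : nrm L2ip (f - g) = 0 <-> ae_eq Q [set: S] f g.
Proof.
rewrite nrm0_ae; split; apply: filterS => x /= H /H /eqP.
  by rewrite subr_eq0 => /eqP.
by rewrite -subr_eq0 => /eqP.
Qed.

Lemma EFin_nrm (f : V) : (nrm L2ip f)%:E = 'N[Q]_2%:E[EFin \o f]%E.
Proof. by rewrite -L2norm_nrm /L2norm fineK //; exact: L2_Lnorm_fin (L2P f). Qed.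

Lemma L1_le_nrm (f : V) : (\int[Q]_x `|f x|%:E <= (nrm L2ip f)%:E)%E.
Proof.
rewrite EFin_nrm.
have mf : measurable_fun [set: S] f by exact: L2_measurable (L2P f).
have := @hoelder _ _ _ Q f (cst 1) 2 2 mf.
have -> : (f : S -> R) \* cst 1 = f by apply/funext => x; rewrite /= mulr1.
rewrite Lnorm1 (Lnorm_cst1 Q) [X in (X `^ _)%E](_ : _ = 1%E); last exact: probability_setT.
rewrite poweR1r mule1; apply=> //.
by rewrite -[2^-1]mul1r -splitr.
Qed.

Lemma sum_half_pow (n : nat) : \sum_(0 <= j < n) (2^-1 : R) ^+ j = 2 - 2 * 2^-1 ^+ n.
Proof.
elim: n => [|n IHn]; first by rewrite big_geq // expr0; lra.
by rewrite big_nat_recr //= IHn exprS; lra.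
Qed.

(** The integral of the sum of [|v j.+1 - v j|] is at most 2, so the telescoping series converges
    absolutely almost everywhere. *)
Lemma fast_cauchy_ae_cvg (v : nat -> V) :
  (forall j, nrm L2ip (v j.+1 - v j) <= 2^-1 ^+ j) ->
  {ae Q, forall x, cvgn (fun j => v j x)}.
Proof.
move=> fast; pose h (j : nat) (x : S) : \bar R := (`|v j.+1 x - v j x|)%:E.
have mv j : measurable_fun [set: S] (v j) by exact: L2_measurable (L2P (v j)).
have mh j : measurable_fun [set: S] (h j).
  by apply/measurable_EFinP; apply: measurableT_comp => //; exact: measurable_funB.
have h0 j x : (0 <= h j x)%E by rewrite lee_fin.
have inth j : (\int[Q]_x h j x <= (2^-1 ^+ j)%:E)%E.
  by apply: le_trans (L1_le_nrm (v j.+1 - v j)) _; rewrite lee_fin.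
have fin : (\int[Q]_x (\sum_(0 <= j <oo) h j x) <= 2%:E)%E.
  rewrite integral_nneseries //; apply: lime_le.
    by apply: is_cvg_nneseries => n _ _; exact: integral_ge0.
  apply: nearW => n; apply: le_trans (lee_sum _ (fun j _ => inth j)) _.
  by rewrite sumEFin lee_fin sum_half_pow gerBl mulr_ge0 // exprn_ge0.
have ints : Q.-integrable [set: S] (fun x => \sum_(0 <= j <oo) h j x)%E.
  apply/integrableP; split.
    by apply: ge0_emeasurable_sum => // j x _ _.
  under eq_integral do rewrite gee0_abs ?nneseries_ge0 //.
  by rewrite (le_lt_trans fin) // ltry.
apply: filterS (integrable_ae measurableT ints) => x /= /(_ I) sfin.
have cs : cvgn (series (fun j => v j.+1 x - v j x)).
  apply: normed_cvg; apply: nondecreasing_is_cvgn.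
    move=> n m nm; rewrite /= /series /= (big_cat_nat _ nm) //= lerDl.
    by rewrite sumr_ge0.
  exists (fine (\sum_(0 <= j <oo) h j x)%E) => _ [n _ <-].
  rewrite -lee_fin fineK // /= /series /= -sumEFin.
  exact: nneseries_lim_ge.
have -> : (fun j => v j x) = (fun j => v 0%N x + series (fun j => v j.+1 x - v j x) j).
  apply/funext => j; rewrite /series /= telescope_sumr // addrC subrK //.
by apply: is_cvgD cs; exact: is_cvg_cst.
Qed.

Lemma limn_einf_le (u : nat -> \bar R) (C : \bar R) :
  (forall n, (u n <= C)%E) -> (limn_einf u <= C)%E.
Proof.
move=> uC; rewrite limn_einf_lim; apply: lime_le; first exact: is_cvg_einfs.
by apply: nearW => n; apply: le_trans (uC n); apply: ereal_inf_lbound; exists n => /=.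
Qed.

(** Riesz-Fischer: an almost everywhere limit along a fast subsequence, with distances to it bounded
    by Fatou's lemma. *)
Lemma L2_complete (u : nat -> V) :
  (forall e : R, 0 < e -> exists N, forall i j, (N <= i)%N -> (N <= j)%N ->
     nrm L2ip (u i - u j) <= e) ->
  exists g, forall e : R, 0 < e ->
    exists N, forall i, (N <= i)%N -> nrm L2ip (u i - g) <= e.
Proof.
move=> cauchy.
have pow_gt0 j : 0 < (2^-1 : R) ^+ j by rewrite exprn_gt0 // invr_gt0.
have [N NP] := choice (fun j => cauchy _ (pow_gt0 j)).
(* Partial sums are monotone and dominate both [N j] and [j]. *)
pose n j := (\sum_(0 <= i < j.+1) (N i).+1)%N.
have nN j : (N j <= n j)%N by rewrite /n big_nat_recr //= (leq_trans (leqnSn _)) // leq_addl.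
have nmono : {homo n : i j / (i <= j)%N}.
  by move=> i j ij; rewrite /n (@big_cat_nat _ _ _ i.+1 0 j.+1) //= leq_addr.
pose v j := u (n j).
have fast j : nrm L2ip (v j.+1 - v j) <= 2^-1 ^+ j.
  by apply: NP => //; apply: leq_trans (nN j) _; apply: nmono.
have cvgv := fast_cauchy_ae_cvg fast.
have mv j : measurable_fun [set: S] (v j) by exact: L2_measurable (L2P (v j)).
(* The upper limit is measurable everywhere; on the null set without convergence its value does not
   matter. *)
pose g (x : S) : R := fine (limn_esup (fun j => (v j x)%:E)).
have mg : measurable_fun [set: S] g.
  apply: measurableT_comp => //; apply: measurable_fun_limn_esup => j.
  exact/measurable_EFinP.
have vg : {ae Q, forall x, (fun j => v j x) @ \oo --> g x}.
  apply: filterS cvgv => x /cvg_ex[l vl].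
  have /cvg_limn_einf_sup[_ E] : (fun j => (v j x)%:E) @ \oo --> l%:E.
    by apply: cvg_EFin; [exact: nearW|exact: vl].
  by rewrite /g E.
have close (w : V) (e : R) (M : nat) : (forall j, (M <= j)%N -> nrm L2ip (v j - w) <= e) ->
    (\int[Q]_x ((g x - w x) ^+ 2)%:E <= (e ^+ 2)%:E)%E.
  move=> H; have mw : measurable_fun [set: S] w by exact: L2_measurable (L2P w).
  pose h (j : nat) (x : S) : \bar R := ((v (M + j)%N x - w x) ^+ 2)%:E.
  have mh j : measurable_fun [set: S] (h j).
    by apply/measurable_EFinP; apply: measurable_funX; exact: measurable_funB.
  have h0 j x : (0 <= h j x)%E by rewrite lee_fin sqr_ge0.
  have -> : (\int[Q]_x ((g x - w x) ^+ 2)%:E = \int[Q]_x limn_einf (h^~ x))%E.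
    apply: ae_eq_integral => //.
    - by apply/measurable_EFinP; apply: measurable_funX; exact: measurable_funB.
    - rewrite /limn_einf; apply: measurableT_comp => //.
      apply: measurable_fun_limn_esup => j; exact: measurableT_comp.
    - apply: filterS vg => x vgx _.
      have /cvg_limn_einf_sup[-> //] : (h^~ x) @ \oo --> ((g x - w x) ^+ 2)%:E.
      apply: cvg_EFin; first by apply: nearW.
      rewrite [X in X @ _ --> _](_ : _ = (fun j => (v (M + j)%N x - w x) ^+ 2)) //.
      rewrite expr2; under eq_fun do rewrite expr2.
      have vgx' : (fun j => v (M + j)%N x) @ \oo --> g x.
        have := vgx; rewrite -(cvg_shiftn M (fun j => v j x)).
        by under eq_fun do rewrite addnC.
      by apply: cvgM; apply: cvgB => //; exact: cvg_cst.
  apply: le_trans (fatou _ _ _ _) _ => //.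
  apply: limn_einf_le => j.
  have -> : (\int[Q]_x h j x = (nrm L2ip (v (M + j)%N - w) ^+ 2)%:E)%E.
    rewrite nrm_sqr /= (EFin_L2inner (L2P (v (M + j)%N - w)) (L2P (v (M + j)%N - w))).
    by apply: eq_integral => x _; rewrite -expr2.
  rewrite lee_fin ler_pXn2r ?nnegrE ?nrm_ge0 ?H ?leq_addr //.
  by rewrite (le_trans (nrm_ge0 _ _) (H M (leqnn _))).
have memL2 (f : S -> R) (e : R) : measurable_fun [set: S] f ->
    (\int[Q]_x (f x ^+ 2)%:E <= (e ^+ 2)%:E)%E -> L2 Q f.
  move=> mf fe; apply: L2_intro => //.
  rewrite ltey; apply/eqP => fy; have := Lnorm2_sqr f.
  by rewrite fy poweRyr // => E; move: fe; rewrite -E leye_eq.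
have vC j : (0 <= j)%N -> nrm L2ip (v j - v 0%N) <= 1.
  move=> _; apply: (NP 0%N); rewrite (leq_trans (nN 0%N)) // nmono //.
have gv0L : L2 Q (fun x => g x - v 0%N x).
  apply: (memL2 _ 1); last exact: close vC.
  exact: measurable_funB.
have gL : L2 Q g.
  have := L2P (Lfun_Sub two_ge1 gv0L + v 0%N).
  by congr (L2 Q _); apply/funext => x /=; rewrite /= subrK.
exists (Lfun_Sub two_ge1 gL) => e e0.
have [M MP] := cauchy e e0; exists M => i Mi.
have nj j : (j <= n j)%N.
  rewrite /n; apply: leq_trans (leq_sum _ (E1 := fun=> 1%N) _) => //.
  by rewrite sum_nat_const_nat subn0 muln1.
have e0' := ltW e0; rewrite nrmBC -(@ler_pXn2r _ 2) ?nnegrE ?nrm_ge0 // nrm_sqr.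
have := close (u i) e M (fun j Mj => MP _ _ (leq_trans Mj (nj j)) Mi).
have giL := L2P (Lfun_Sub two_ge1 gL - u i).
rewrite -lee_fin /= (EFin_L2inner giL giL).
apply: le_trans; rewrite le_eqVlt; apply/orP; left; apply/eqP.
by apply: eq_integral => x _; rewrite -expr2.
Qed.

End L2_space.

(** * Stochastic order and conditional expectations *)

Lemma cvge_near_lt {R : realType} (u : nat -> \bar R) (l x : \bar R) :
  u @ \oo --> l -> (l < x)%E -> \forall n \near \oo, (u n < x)%E.
Proof. by move=> ul lx; exact: (ul _ (open_ereal_lt' lx)). Qed.

Section outer_probability.
Context {dO : measure_display} {Omega : measurableType dO} {R : realType}.
Variable P : probability Omega R.

Lemma outer_prob_lt_U (E F G : set Omega) (a b : R) : G `<=` E `|` F ->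
  (outer_prob P E < a%:E)%E -> (outer_prob P F < b%:E)%E ->
  (outer_prob P G < (a + b)%:E)%E.
Proof.
move=> GEF /ereal_inf_lt[_ [A [mA EA] <-] PA] /ereal_inf_lt[_ [B [mB FB] <-] PB].
apply: (@le_lt_trans _ _ (P (A `|` B))).
  apply: ereal_inf_lbound; exists (A `|` B) => //; split; first exact: measurableU.
  by apply: subset_trans GEF _; exact: setUSS.
apply: le_lt_trans (measureU2 P mA mB) _.
by rewrite EFinD lteD.
Qed.

(** Reduces a stochastic rate to a deterministic implication, for large [n] and each outcome,
    outside three events of small outer probability. *)
Lemma Op_bound (Y1 Y2 Y3 Z : nat -> Omega -> R) (a3 a : nat -> R) :
  op1 P Y1 -> op1 P Y2 -> Op P Y3 a3 ->
  (forall C3 : R, exists d C : R, 0 < d /\ \forall n \near \oo, forall w : Omega,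
     `|Y1 n w| <= d -> `|Y2 n w| <= d -> `|Y3 n w| <= C3 * a3 n -> `|Z n w| <= C * a n) ->
  Op P Z a.
Proof.
move=> o1 o2 O3 H e e0; have e4 : 0 < e / 4 by rewrite divr_gt0.
have [C3 HC3] := O3 _ e4; have [d [C [d0 HC]]] := H C3; exists C.
have small (Y : nat -> Omega -> R) : op1 P Y ->
    \forall n \near \oo, (outer_prob P [set w | (d < `|Y n w|)%R] < (e / 4)%:E)%E.
  by move=> o; apply: cvge_near_lt (o d d0) _; rewrite lte_fin.
apply: filterS (filterI (filterI HC HC3) (filterI (small _ o1) (small _ o2))).
move=> n [[HCn H3n] [H1n H2n]]; apply/ltW.
(* [Op] bounds the third event by [e / 4] only weakly; [e / 2] makes it strict. *)
have -> : e = e / 4 + (e / 4 + (e / 2)) by lra.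
apply: outer_prob_lt_U H1n (outer_prob_lt_U (@subset_refl _ _) H2n (le_lt_trans H3n _)).
  move=> w /= Zw; rewrite !ltNge; have [h1|_] := leP (`|Y1 n w|) d; last by left.
  have [h2|_] := leP (`|Y2 n w|) d; last by right; left.
  have [h3|_] := leP (`|Y3 n w|) (C3 * a3 n); last by right; right.
  by move: Zw; rewrite ltNge HCn.
by rewrite lte_fin; lra.
Qed.

End outer_probability.

Section conditional_expectation.
Context {dO dS : measure_display} {Omega : measurableType dO}
  {S : measurableType dS} {R : realType}.
Variables (P : probability Omega R) (Q : probability S R).

Lemma ge0_integral_law (Z : {RV P >-> S}) (f : S -> \bar R) :
  (forall A, measurable A -> P (Z @^-1` A) = Q A) ->
  measurable_fun [set: S] f -> (forall x, (0 <= f x)%E) ->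
  (\int[P]_w f (Z w) = \int[Q]_x f x)%E.
Proof.
move=> law mf f0.
have := @ge0_integral_pushforward _ _ _ _ _ Z (measurable_funPT Z) P [set: S] f measurableT mf.
rewrite preimage_setT => <- //; apply: eq_measure_integral => A mA _.
exact: law.
Qed.

Lemma integral_law (Z : {RV P >-> S}) (f : S -> \bar R) :
  (forall A, measurable A -> P (Z @^-1` A) = Q A) ->
  measurable_fun [set: S] f -> (\int[P]_w f (Z w) = \int[Q]_x f x)%E.
Proof.
move=> law mf; rewrite integralE [RHS]integralE.
rewrite -(ge0_integral_law law (measurable_funepos mf)) //.
rewrite -(ge0_integral_law law (measurable_funeneg mf)) //.
by rewrite -[fun x => f (Z x)]/(f \o Z) funepos_comp funeneg_comp.
Qed.

Lemma integrable_law (Z : {RV P >-> S}) (f : S -> \bar R) :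
  (forall A, measurable A -> P (Z @^-1` A) = Q A) ->
  Q.-integrable [set: S] f -> P.-integrable [set: Omega] (f \o Z).
Proof.
move=> law /integrableP[mf fi]; apply/integrableP; split.
  by apply: measurableT_comp => //; exact: measurable_funPT.
have := @integral_law Z (abse \o f) law; rewrite /= => -> //.
exact: measurableT_comp.
Qed.

Import HBNNSimple.

Lemma integral_mul_nnsfun (Z : {RV P >-> S}) (U : Omega -> R) (h : {nnsfun S >-> R}) :
  P.-integrable [set: Omega] (EFin \o U) ->
  (\int[P]_w (U w * h (Z w))%:E =
   \sum_(r <- fset_set (range h)) r%:E * \int[P]_(w in Z @^-1` (h @^-1` [set r])) (U w)%:E)%E.
Proof.
move=> Ui; have mU : measurable_fun [set: Omega] U.
  by apply/measurable_EFinP; case/integrableP: Ui.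
have mA r : measurable (Z @^-1` (h @^-1` [set r])).
  by rewrite -[_ @^-1` _]setTI; apply: measurable_funPT.
have -> : (fun w => (U w * h (Z w))%:E) = (fun w => \sum_(r <- fset_set (range h))
    r%:E * ((EFin \o U) \_ (Z @^-1` (h @^-1` [set r])) w))%E.
  apply/funext => w; rewrite [in h _](fimfunE h) fsbig_finite //= mulr_sumr -sumEFin.
  apply: eq_bigr => r _; rewrite /patch /indic /=.
  have -> : (w \in Z @^-1` (h @^-1` [set r])) = (Z w \in h @^-1` [set r]).
    by apply/idP/idP => /set_mem ?; apply/mem_set.
  case: ifPn; rewrite ?mulr1 ?mulr0 ?mule0 // EFinM muleC //.
have Ur r : P.-integrable [set: Omega] ((EFin \o U) \_ (Z @^-1` (h @^-1` [set r]))).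
  apply/(integrable_mkcond _ (mA r)).1.
  by apply: (integrableS measurableT (mA r) _ Ui).
rewrite integral_sum //; last by move=> r; exact: integrableZl.
by apply: eq_bigr => r _; rewrite integralZl // -integral_mkcond.
Qed.

(** The definition tests indicators only, so [h] is approximated by simple functions. On the left
    integrability is unknown but signs are, whence monotone convergence; on the right [g] has no
    sign, but [|g h|] dominates. *)
Lemma cond_exp_mul (Z : {RV P >-> S}) (Y : Omega -> R) (g h : S -> R) :
  (forall w, 0 <= Y w) -> (forall x, 0 <= h x) -> measurable_fun [set: S] h ->
  is_cond_exp P Y Z g -> P.-integrable [set: Omega] (EFin \o (g \o Z)) ->
  P.-integrable [set: Omega] (fun w => (g (Z w) * h (Z w))%:E) ->
  (\int[P]_w (Y w * h (Z w))%:E = \int[P]_w (g (Z w) * h (Z w))%:E)%E.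
Proof.
move=> Y0 h0 mh [Yi mg YgE] gi ghi.
have mY : measurable_fun [set: Omega] Y.
  by apply/measurable_EFinP; case/integrableP: Yi.
have mhE : measurable_fun [set: S] (EFin \o h) by exact/measurable_EFinP.
pose hn := nnsfun_approx measurableT mhE.
have hnE0 x : [set: S] x -> (0 <= (EFin \o h) x)%E by rewrite lee_fin.
have mhn n : measurable_fun [set: Omega] (fun w => hn n (Z w)).
  by apply: measurableT_comp => //; exact: measurable_funPT.
have mgZ : measurable_fun [set: Omega] (g \o Z).
  by apply: measurableT_comp => //; exact: measurable_funPT.
have hn_le n x : hn n x <= h x.
  rewrite -lee_fin /hn nnsfun_approxE.
  exact: (@le_approx _ _ _ setT (EFin \o h) n x hnE0).
have hn_cvg x : (fun n => (hn n x)%:E) @ \oo --> (h x)%:E.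
  exact: (@cvg_nnsfun_approx _ _ _ setT measurableT (EFin \o h) mhE hnE0 x I).
have mono : (fun n => \int[P]_w (Y w * hn n (Z w))%:E)%E @ \oo -->
    (\int[P]_w (Y w * h (Z w))%:E)%E.
  have -> : (fun w => (Y w * h (Z w))%:E) =
      (fun w => limn (fun n => (Y w * hn n (Z w))%:E)).
    apply/funext => w; apply/esym/cvg_lim => //.
    under eq_fun do rewrite EFinM; rewrite EFinM.
    by apply: cvgeZl.
  apply: cvg_monotone_convergence => //.
  - by move=> n; apply/measurable_EFinP; exact: measurable_funM.
  - by move=> n w _; rewrite lee_fin mulr_ge0.
  - move=> w _ i j ij; rewrite lee_fin ler_wpM2l //.
    exact/lefP/nd_nnsfun_approx.
have [|||||_ _ dom] := @dominated_convergence _ _ _ P [set: Omega] measurableT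
  (fun n w => (g (Z w) * hn n (Z w))%:E) (fun w => (g (Z w) * h (Z w))%:E)
  (fun w => `|(g (Z w) * h (Z w))%:E|%E).
- by move=> n; apply/measurable_EFinP; exact: measurable_funM.
- by case/integrableP: ghi.
- apply: aeW => w _; rewrite EFinM; under eq_fun do rewrite EFinM.
  by apply: cvgeZl.
- exact: integrable_abse.
- apply: aeW => w j _ /=; rewrite lee_fin !normrM ler_wpM2l //.
  by rewrite !ger0_norm.
have E : (fun n => \int[P]_w (Y w * hn n (Z w))%:E)%E =
    (fun n => \int[P]_w (g (Z w) * hn n (Z w))%:E)%E.
  apply/funext => n; rewrite integral_mul_nnsfun // (@integral_mul_nnsfun Z (g \o Z)) //.
  apply: eq_bigr => r _; congr (_ * _)%E; apply: YgE.
  by rewrite -[_ @^-1` _]setTI; apply: measurable_funPT.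
rewrite E in mono; exact: (cvg_unique (@ereal_hausdorff R) mono dom).
Qed.

End conditional_expectation.

Section L2_functions.
Context {d : measure_display} {S : measurableType d} {R : realType}.
Variable Q : probability S R.
Implicit Types f g h : S -> R.

Lemma L2_abs f : L2 Q f -> L2 Q (fun x => `|f x|).
Proof.
move=> fL; apply: L2_intro; first exact: measurableT_comp (L2_measurable fL).
have := L2_Lnorm_fin fL; rewrite -(Lnorm_abse _ (EFin \o f)).
by rewrite ge0_fin_numE ?Lnorm_ge0.
Qed.

Lemma L2_sub f g : L2 Q f -> L2 Q g -> L2 Q (fun x => f x - g x).
Proof.
by move=> fL gL; exact: (L2P (Lfun_Sub two_ge1 fL - Lfun_Sub two_ge1 gL)).
Qed.

Lemma L2innerC f g : L2inner Q f g = L2inner Q g f.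
Proof. by apply: eq_Rintegral => x _; rewrite mulrC. Qed.

Lemma L2innerBl f g h : L2 Q f -> L2 Q g -> L2 Q h ->
  L2inner Q (fun x => f x - g x) h = L2inner Q f h - L2inner Q g h.
Proof.
move=> fL gL hL; rewrite /L2inner -RintegralB //; try exact: L2_integrableM.
by apply: eq_Rintegral => x _; rewrite mulrBl.
Qed.

End L2_functions.

(** * The conditional expectation operator as a bilinear form *)

Section kernel_operator.
Context {dO dS : measure_display} {Omega : measurableType dO}
  {S : measurableType dS} {R : realType}.
Variables (P : probability Omega R) (Q : probability S R).
Variables (Z0 Z1 : {RV P >-> S}) (w0 : Omega -> R) (T T' : (S -> R) -> (S -> R)).
Hypothesis Z0_law : forall A, measurable A -> P (Z0 @^-1` A) = Q A.
Hypothesis w0_ge0 : forall w, 0 <= w0 w.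
Hypothesis T_L2 : forall psi, L2 Q psi -> L2 Q (T psi).
Hypothesis T_adj : L2adjoint Q T T'.
Hypothesis T_cond : forall psi, L2 Q psi ->
  is_cond_exp P (fun w => w0 w * psi (Z1 w)) Z0 (T psi).

Lemma kernel_inner_ge0 h psi : L2 Q h -> L2 Q psi ->
  (forall x, 0 <= h x) -> (forall x, 0 <= psi x) ->
  P.-integrable [set: Omega] (fun w => (h (Z0 w) * w0 w * psi (Z1 w))%:E) /\
  \int[P]_w (h (Z0 w) * w0 w * psi (Z1 w)) = L2inner Q h (T psi).
Proof.
move=> hL psiL h0 psi0; have TL := T_L2 psiL; have cond := T_cond psiL.
have mY : measurable_fun [set: Omega] (fun w => w0 w * psi (Z1 w)).
  by apply/measurable_EFinP; case: cond => /integrableP[].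
have mh := L2_measurable hL.
have gh : P.-integrable [set: Omega] (fun w => (T psi (Z0 w) * h (Z0 w))%:E).
  exact: integrable_law Z0_law (L2_integrableM TL hL).
have g1 : P.-integrable [set: Omega] (EFin \o (T psi \o Z0)).
  apply: (integrable_law (f := EFin \o T psi) Z0_law).
  apply/Lfun1_integrable; apply: Lfun_subset12 TL; exact: fin_num_measure.
have E : (\int[P]_w (h (Z0 w) * w0 w * psi (Z1 w))%:E = (L2inner Q h (T psi))%:E)%E.
  rewrite L2innerC EFin_L2inner // -(integral_law Z0_law); last first.
    by apply/measurable_EFinP; apply: measurable_funM => //; exact: L2_measurable TL.
  rewrite -(@cond_exp_mul _ _ _ _ _ P Z0 (fun w => w0 w * psi (Z1 w))) //.
    by apply: eq_integral => w _; congr (_%:E); ring.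
  by move=> w; rewrite mulr_ge0.
split; last by rewrite /Rintegral E.
have pos w : 0 <= h (Z0 w) * w0 w * psi (Z1 w) by rewrite !mulr_ge0.
apply/integrableP; split.
  apply/measurable_EFinP; under eq_fun do rewrite -mulrA.
  by apply: measurable_funM => //; apply: measurableT_comp => //; exact: measurable_funPT.
under eq_integral do rewrite gee0_abs ?lee_fin //.
by rewrite E ltry.
Qed.

(* Writing f = |f| - (|f| - f) reduces the formula to nonnegative functions, for
   which monotone convergence also yields the integrability of the product. *)
Lemma kernel_inner h psi : L2 Q h -> L2 Q psi ->
  \int[P]_w (h (Z0 w) * w0 w * psi (Z1 w)) = L2inner Q h (T psi).
Proof.
move=> hL psiL.
pose pos (f : S -> R) (x : S) : R := `|f x|; pose neg (f : S -> R) (x : S) : R := `|f x| - f x.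
have [posL negL] : (forall f, L2 Q f -> L2 Q (pos f)) /\ (forall f, L2 Q f -> L2 Q (neg f)).
  by split=> f fL; [exact: L2_abs|exact: L2_sub (L2_abs fL) fL].
have pos0 f x : 0 <= pos f x by exact: normr_ge0.
have neg0 f x : 0 <= neg f x by rewrite subr_ge0 ler_norm.
have split_fun f : f = (fun x => pos f x - neg f x).
  by apply/funext => x; rewrite /pos /neg opprB addrC subrK.
(* Additivity of [T] is not given; through the adjoint the form becomes an inner product linear in
   [f]. *)
have dual f g : L2 Q f -> L2 Q g -> L2inner Q g (T f) = L2inner Q f (T' g).
  by move=> fL gL; rewrite L2innerC; have [_] := T_adj gL; apply.
have [i11 e11] := kernel_inner_ge0 (posL _ hL) (posL _ psiL) (pos0 _) (pos0 _).
have [i12 e12] := kernel_inner_ge0 (posL _ hL) (negL _ psiL) (pos0 _) (neg0 _).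
have [i21 e21] := kernel_inner_ge0 (negL _ hL) (posL _ psiL) (neg0 _) (pos0 _).
have [i22 e22] := kernel_inner_ge0 (negL _ hL) (negL _ psiL) (neg0 _) (neg0 _).
have -> : \int[P]_w (h (Z0 w) * w0 w * psi (Z1 w)) =
    \int[P]_w ((pos h (Z0 w) * w0 w * pos psi (Z1 w) - pos h (Z0 w) * w0 w * neg psi (Z1 w))
     - (neg h (Z0 w) * w0 w * pos psi (Z1 w) - neg h (Z0 w) * w0 w * neg psi (Z1 w))).
  by apply: eq_Rintegral => w _; rewrite /pos /neg; ring.
rewrite !RintegralB //; try first
  [exact: (integrableB measurableT i11 i12)|exact: (integrableB measurableT i21 i22)].
rewrite e11 e12 e21 e22 !dual //; try by [apply: posL|apply: negL].
have [[T1 _] [T2 _]] := (T_adj (posL _ hL), T_adj (negL _ hL)).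
have innerB g : L2 Q g -> L2inner Q (pos psi) g - L2inner Q (neg psi) g = L2inner Q psi g.
  by move=> gL; rewrite -(L2innerBl (posL _ psiL) (negL _ psiL) gL) -(split_fun psi).
rewrite !innerB // -(dual _ _ psiL (posL _ hL)) -(dual _ _ psiL (negL _ hL)).
rewrite -(L2innerBl (posL _ hL) (negL _ hL) (T_L2 psiL)) -(split_fun h).
exact: dual.
Qed.

End kernel_operator.

(** * Existence of a largest real generalized eigenvalue *)

Section largest_eigenvalue.
Context {R : realType}.

Lemma poly_largest_root (p : {poly R}) (a : R) : p != 0 -> root p a ->
  exists r, root p r /\ forall r', root p r' -> r' <= r.
Proof.
move: {2}(size p) (leqnn (size p)) => n; elim: n p a => [|n IHn] p a.
  by rewrite leqn0 size_poly_eq0 => /eqP ->; rewrite eqxx.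
move=> pn p0 /factor_theorem[q pq].
have q0 : q != 0 by apply: contra p0 => /eqP q0; rewrite pq q0 mul0r.
have qn : (size q <= n)%N.
  by move: pn; rewrite pq size_Mmonic ?monicXsubC // size_XsubC addn2.
have rootE r : root p r = root q r || (r == a) by rewrite pq rootM root_XsubC.
have [[b qb]|nq] := pselect (exists b, root q b); last first.
  exists a; rewrite rootE eqxx orbT; split=> // r; rewrite rootE => /orP[qr|/eqP -> //].
  by case: nq; exists r.
have [r [qr rmax]] := IHn q b qn q0 qb.
exists (Num.max r a); split.
  by rewrite rootE; case: (leP r a); rewrite ?eqxx ?orbT ?qr.
by move=> r'; rewrite rootE le_max => /orP[/rmax ->|/eqP ->]; rewrite ?lexx ?orbT.
Qed.

(** The generalized eigenvalues are the real roots of a characteristic polynomial, transposed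
    because [eigenvalue] refers to row vectors. *)
Lemma gen_eigenvalue_largest (k : nat) (A G : 'M[R]_k) (r : R) : G \in unitmx ->
  gen_eigenvalue A G r -> exists r', largest_gen_eigenvalue A G r'.
Proof.
move=> uG; have E t : gen_eigenvalue A G t <-> root (char_poly (invmx G *m A)^T) t.
  rewrite -eigenvalue_root_char; split.
    move=> [c c0 Ac]; apply/eigenvalueP; exists c^T.
      by rewrite -trmx_mul -mulmxA Ac -scalemxAr mulKmx // linearZ.
    by apply: contra c0 => /eqP c0; rewrite -[c]trmxK c0 trmx0.
  move=> /eigenvalueP[v vA v0]; exists v^T.
    by apply: contra v0 => /eqP c0; rewrite -[v]trmxK c0 trmx0.
  have := congr1 trmx vA; rewrite trmx_mul trmxK linearZ /= => e.
  by rewrite -[A in LHS](mulKVmx uG) -mulmxA -mulmxA [invmx G *m _]mulmxA e -scalemxAr.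
move=> /E/poly_largest_root[|r' [/E r1 r2]].
  by rewrite monic_neq0 ?char_poly_monic.
by exists r'; split=> // t /E/r2.
Qed.

End largest_eigenvalue.

(** * Sieve coordinates *)

Section sieve_coordinates.
Context {d : measure_display} {S : measurableType d} {R : realType}.
Variables (Q : probability S R) (k : nat) (b : 'I_k -> S -> R) (H : 'M[R]_k).
Local Notation V := (LfunType Q two_ge1).
Local Notation ipQ := (L2ip Q).
Hypothesis b_L2 : forall i, L2 Q (b i).
Hypothesis b_indep : L2_lin_indep Q b.
Hypothesis H_sqrt : is_psd_sqrt (\matrix_(i, j) L2inner Q (b i) (b j)) H.

Definition basis_fun (i : 'I_k) : V := Lfun_Sub two_ge1 (b_L2 i).

Definition basis_comb (v : 'cV[R]_k) : V := \sum_i v i ord0 *: basis_fun i.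

Lemma sum_LfunE (I : Type) (r : seq I) (f : I -> V) x :
  (\sum_(i <- r) f i) x = \sum_(i <- r) f i x.
Proof. by elim/big_rec2: _ => [//|i a c _ <-]. Qed.

Lemma basis_combE v : basis_comb v = sieve_fun b v :> (S -> R).
Proof. by apply/funext => x; rewrite sum_LfunE. Qed.

Lemma basis_combD v w : basis_comb (v + w) = basis_comb v + basis_comb w.
Proof. by rewrite -big_split; apply: eq_bigr => i _; rewrite mxE scalerDl. Qed.

Lemma basis_combZ a v : basis_comb (a *: v) = a *: basis_comb v.
Proof. by rewrite scaler_sumr; apply: eq_bigr => i _; rewrite mxE scalerA. Qed.

Lemma ip_basis_comb v (f : V) : ipQ (basis_comb v) f = dot v (\col_i ipQ (basis_fun i) f).
Proof. by rewrite ip_sum_l; apply: eq_bigr => i _; rewrite ipZl mxE. Qed.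

Lemma basis_comb_ip v w : ipQ (basis_comb v) (basis_comb w) = dot (H *m v) (H *m w).
Proof.
have [HT _ HH] := H_sqrt.
rewrite dot_mull HT mulmxA HH ip_basis_comb; congr (dot v _); apply/colP => i.
rewrite !mxE ipC ip_basis_comb; apply: eq_bigr => j _; rewrite !mxE mulrC; congr (_ * _).
by rewrite /= L2innerC.
Qed.

Lemma sqrt_unitmx : H \in unitmx.
Proof.
have [HT _ HH] := H_sqrt; rewrite unitmxE unitfE; apply/det0P => -[v v0 vH].
have Hv : H *m v^T = 0 by rewrite -{1}HT -trmx_mul vH trmx0.
move: v0; rewrite -[v]trmxK; suff -> : v^T = 0 by rewrite trmx0 eqxx.
apply: b_indep; rewrite -basis_combE; apply/nrm0_ae.
by rewrite /nrm basis_comb_ip Hv ip0l sqrtr0.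
Qed.

Definition ortho_comb (v : 'cV[R]_k) : V := basis_comb (invmx H *m v).

Lemma ortho_combE v : ortho_comb (H *m v) = sieve_fun b v :> (S -> R).
Proof. by rewrite /ortho_comb mulKmx ?sqrt_unitmx // basis_combE. Qed.

Lemma ortho_combD v w : ortho_comb (v + w) = ortho_comb v + ortho_comb w.
Proof. by rewrite /ortho_comb mulmxDr basis_combD. Qed.

Lemma ortho_combZ a v : ortho_comb (a *: v) = a *: ortho_comb v.
Proof. by rewrite /ortho_comb -scalemxAr basis_combZ. Qed.

Lemma ortho_comb_ip v w : ipQ (ortho_comb v) (ortho_comb w) = dot v w.
Proof. by rewrite basis_comb_ip !mulKVmx ?sqrt_unitmx. Qed.

(** The adjoint of the isometry [ortho_comb]: coordinates of the projection of [f] in the basis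
    orthonormalized by [G^{-1/2}]. *)
Definition ortho_coord (f : V) : 'cV[R]_k := invmx H *m \col_i ipQ (basis_fun i) f.

Lemma ortho_coordE f w : dot (ortho_coord f) w = ipQ f (ortho_comb w).
Proof.
have [HT _ _] := H_sqrt.
by rewrite ipC [RHS]ipC ip_basis_comb dot_mull trmx_inv HT.
Qed.

Lemma ortho_coord_uniq f p : (forall w, dot p w = ipQ f (ortho_comb w)) -> p = ortho_coord f.
Proof.
move=> pE; apply/eqP; rewrite -subr_eq0; apply/eqP/nrm_dot_eq0.
by rewrite /nrm ipBl pE ortho_coordE subrr sqrtr0.
Qed.

Lemma ortho_coord_le f : nrm dot (ortho_coord f) <= nrm ipQ f.
Proof.
apply: nrm_dual_le => [|w]; first exact: nrm_ge0.
rewrite ortho_coordE (le_trans (ip_le _ _ _)) //.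
by rewrite /nrm ortho_comb_ip.
Qed.

Lemma sieve_projE (f : V) : sieve_proj Q b f = ortho_comb (ortho_coord f).
Proof.
have uH := sqrt_unitmx; rewrite /sieve_proj; case: xgetP => [g _|].
  (* Both sides are combinations of the basis, so equal coordinates give equal functions, not just
     equality almost everywhere. *)
  move=> [[v vE] orth]; rewrite vE -ortho_combE; congr (Lfunction.sort (ortho_comb _)).
  apply: ortho_coord_uniq => w; rewrite -ortho_comb_ip; apply/eqP.
  rewrite eq_sym -subr_eq0 -ipBl; apply/eqP.
  have := orth (invmx H *m w); rewrite vE -ortho_combE -basis_combE; exact.
move=> /(_ (ortho_comb (ortho_coord f))) [].
split=> [|v].
  by exists (invmx H *m ortho_coord f); rewrite -basis_combE.
rewrite -ortho_combE.
apply: etrans (_ : ipQ (f - ortho_comb (ortho_coord f)) (ortho_comb (H *m v)) = 0) => //.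
by rewrite ipBl ortho_comb_ip -ortho_coordE subrr.
Qed.

Section galerkin_matrix.
Variables (T T' : V -> V) (M : 'M[R]_k).
Hypothesis T_adj : forall x y, ipQ (T x) y = ipQ x (T' y).
Hypothesis M_E : forall i j, M i j = ipQ (basis_fun i) (T (basis_fun j)).

Lemma orthogonalize_ip v w :
  dot v (orthogonalize H M *m w) = ipQ (ortho_comb v) (T (ortho_comb w)).
Proof.
have [HT _ _] := H_sqrt.
rewrite /orthogonalize -!mulmxA -{1}HT -trmx_inv -dot_mull.
rewrite ip_basis_comb; congr (dot _ _); apply/colP => i; rewrite !mxE.
(* The combination inside [T] is expanded on the other side of the adjoint. *)
rewrite ipC T_adj ip_basis_comb; apply: eq_bigr => j _; rewrite !mxE mulrC M_E.
by rewrite -T_adj ipC.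
Qed.

Lemma galerkin_coord w : orthogonalize H M *m w = ortho_coord (T (ortho_comb w)).
Proof. by apply: ortho_coord_uniq => v; rewrite ipC orthogonalize_ip ipC. Qed.

End galerkin_matrix.
End sieve_coordinates.

(** * Sample and population matrices *)

Section gram_perturbation.
Context {R : realType} {k : nat}.
Variables (Go Mo A0 : 'M[R]_k) (K e : R).
Hypotheses (K_ge0 : 0 <= K) (e_half : e <= 2^-1).
Hypothesis A0_le : forall w, nrm dot (A0 *m w) <= K * nrm dot w.
Hypothesis Go_1 : forall w, nrm dot ((Go - 1%:M) *m w) <= e * nrm dot w.
Hypothesis Mo_A0 : forall w, nrm dot ((Mo - A0) *m w) <= e * nrm dot w.

Lemma gram_low w : 2^-1 * nrm dot w <= nrm dot (Go *m w).
Proof.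
have := Go_1 w; rewrite mulmxBl mul1mx; have := nrm_ge_sub dot w (Go *m w).
by rewrite nrmBC; have := ler_wpM2r (nrm_ge0 dot w) e_half; lra.
Qed.

Lemma gram_unitmx : Go \in unitmx.
Proof. by apply: (@bounded_below_unitmx _ _ _ 2^-1) => // w; exact: gram_low. Qed.

Lemma gram_inv_le w : nrm dot (invmx Go *m w) <= 2 * nrm dot w.
Proof.
have := @bounded_below_inv _ _ Go 2^-1 w; rewrite invrK [_ * 2]mulrC; apply=> //.
exact: gram_low.
Qed.

(** [Go^-1 Mo - A0 = Go^-1 ((Mo - A0) - (Go - 1) A0)], with [Go^-1] of norm at most 2. For the
    product in the other order, [Go^-1] factors out on the right. *)
Lemma gram_inv_mull w :
  nrm dot ((invmx Go *m Mo) *m w - A0 *m w) <= 2 * e * (1 + K) * nrm dot w.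
Proof.
have -> : (invmx Go *m Mo) *m w - A0 *m w =
    invmx Go *m ((Mo - A0) *m w - (Go - 1%:M) *m (A0 *m w)).
  rewrite [RHS]mulmxBr !mulmxBl mul1mx [in RHS]mulmxBr [invmx Go *m (Go *m _ - _)]mulmxBr.
  by rewrite mulKmx ?gram_unitmx // opprB addrA subrK mulmxA.
rewrite (le_trans (gram_inv_le _)) // -!mulrA ler_pM2l //.
rewrite (le_trans (nrmB _ _ _)) //.
have := Mo_A0 w; have := Go_1 (A0 *m w); have := A0_le w.
have : 0 <= e * nrm dot w by exact: le_trans (nrm_ge0 _ _) (Go_1 w).
have := nrm_ge0 dot w; rewrite le_eqVlt => /orP[/eqP w0|w0].
  rewrite (nrm_dot_eq0 (esym w0)) !mulmx0 nrm0; lra.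
rewrite pmulr_lge0 // => e0 h1 h2 h3; have := ler_wpM2l e0 h1; lra.
Qed.

Lemma gram_inv_mulr w :
  nrm dot ((Mo *m invmx Go) *m w - A0 *m w) <= 2 * e * (1 + K) * nrm dot w.
Proof.
pose y := invmx Go *m w.
have wE : w = Go *m y by rewrite mulKVmx // gram_unitmx.
have -> : (Mo *m invmx Go) *m w - A0 *m w = (Mo - A0) *m y - A0 *m ((Go - 1%:M) *m y).
  rewrite -mulmxA -/y [in A0 *m w]wE !mulmxBl mul1mx mulmxBr opprB addrA subrK //.
rewrite (le_trans (nrmB _ _ _)) //.
have := Mo_A0 y; have := A0_le ((Go - 1%:M) *m y); have := Go_1 y.
have y2 : nrm dot y <= 2 * nrm dot w := gram_inv_le w.
have := nrm_ge0 dot y; rewrite le_eqVlt => /orP[/eqP y0|y0].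
  by rewrite wE (nrm_dot_eq0 (esym y0)) !mulmx0 nrm0; lra.
move=> h1 h2 h3; have e0 : 0 <= e.
  by have := le_trans (nrm_ge0 _ _) h1; rewrite pmulr_lge0.
have h4 := ler_wpM2l e0 y2.
have := ler_wpM2l K_ge0 (le_trans h1 h4); lra.
Qed.

End gram_perturbation.

Section orthogonalized_eigen.
Context {R : realType} {k : nat}.
Variables (H : 'M[R]_k).
Hypotheses (H_sym : H^T = H) (H_unit : H \in unitmx).
Implicit Types (A G : 'M[R]_k) (v : 'cV[R]_k).

Lemma orthogonalize_mul A v : orthogonalize H A *m (H *m v) = invmx H *m (A *m v).
Proof. by rewrite /orthogonalize -!mulmxA mulKmx. Qed.

Lemma orthogonalize_tr A : (orthogonalize H A)^T = orthogonalize H A^T.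
Proof. by rewrite /orthogonalize !trmx_mul trmx_inv H_sym mulmxA. Qed.

Lemma orthogonalize_sqr : orthogonalize H (H *m H) = 1%:M.
Proof. by rewrite /orthogonalize mulKmx // mulmxV. Qed.

Lemma orthogonalize_eigen A G r v : A *m v = r *: (G *m v) ->
  orthogonalize H A *m (H *m v) = r *: (orthogonalize H G *m (H *m v)).
Proof. by move=> Av; rewrite !orthogonalize_mul Av -scalemxAr. Qed.

Lemma orthogonalize_left_eigen A G r v : v^T *m A = r *: (v^T *m G) ->
  (orthogonalize H A)^T *m (H *m v) = r *: ((orthogonalize H G)^T *m (H *m v)).
Proof.
move=> vA; rewrite !orthogonalize_tr; apply: orthogonalize_eigen.
by have := congr1 trmx vA; rewrite linearZ /= !trmx_mul trmxK.
Qed.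

Lemma gen_eigenvalue_orthogonalize A G r v : v != 0 ->
  orthogonalize H A *m v = r *: (orthogonalize H G *m v) -> gen_eigenvalue A G r.
Proof.
move=> v0; rewrite -[v](mulKVmx H_unit) !orthogonalize_mul => Av.
exists (invmx H *m v).
  by apply: contra v0 => /eqP v0; rewrite -[v](mulKVmx H_unit) v0 mulmx0.
have := congr1 (mulmx H) Av; rewrite mulKVmx // => ->.
by rewrite -scalemxAr mulKVmx.
Qed.

Lemma orthogonalize_unitmx G : orthogonalize H G \in unitmx -> G \in unitmx.
Proof. by rewrite /orthogonalize !unitmx_mul unitmx_inv => /andP[/andP[]]. Qed.

End orthogonalized_eigen.

(** * Error bounds for one sieve dimension and one outcome *)

Section sieve_estimator.
Context {dS : measure_display} {S : measurableType dS} {R : realType}.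
Variable Q : probability S R.
Local Notation V := (LfunType Q two_ge1).
Local Notation s := (L2ip Q).
Variables (T T' : V -> V) (K rho c eps d e : R) (phi phis : V).
Let B := 4 / c * (1 + 4 / c).
Let D2 := 2 * (B * (2 + K + rho) + 1).
Hypothesis T_adj : forall x y, s (T x) y = s x (T' y).
Hypothesis T_le : forall x, nrm s (T x) <= K * nrm s x.
Hypothesis T_phi : nrm s (T phi - rho *: phi) = 0.
Hypothesis T_phis : forall x, s phis (T x) = rho * s phis x.
Hypotheses (phi1 : nrm s phi = 1) (phis1 : nrm s phis = 1).
Hypotheses (K_ge0 : 0 <= K) (rho_gt0 : 0 < rho) (c_gt0 : 0 < c).
Hypothesis T_low : forall z x, rho - c <= z ->
  c * nrm s x <= nrm s (T x - s phis x *: phi - z *: x).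
Hypotheses (eps_gt0 : 0 < eps) (eps_c : eps <= c) (eps_phi : eps < s phis phi)
  (d_eps : d * (1 + 8 / c) < eps).
Hypotheses (d_gt0 : 0 < d) (d_le1 : d <= 1) (d_c : 4 * (D2 * d) <= c)
  (d_c2 : 32 * d <= c ^+ 2) (d_BK : 2 * (1 + B * K) * d <= 1).
Hypotheses (e_half : e <= 2^-1) (e_K : 4 * e * (1 + K) <= d).

Variables (k : nat) (b : 'I_k -> S -> R) (H M : 'M[R]_k).
Hypothesis b_L2 : forall i, L2 Q (b i).
Hypothesis b_indep : L2_lin_indep Q b.
Hypothesis H_sqrt : is_psd_sqrt (\matrix_(i, j) L2inner Q (b i) (b j)) H.
Hypothesis M_E : forall i j, M i j = s (basis_fun b_L2 i) (T (basis_fun b_L2 j)).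
Let F := ortho_comb H b_L2.
Let p := ortho_coord H b_L2.
(** The other half of the tolerance is left to the sample error. The variant with [rho * d] serves
    the projection of [phi], which is [T phi / rho]. *)
Hypothesis proj_half : forall f, nrm s (F (p (T f)) - T f) <= d / 2 * nrm s f.
Hypothesis proj_rho : forall f, nrm s (F (p (T f)) - T f) <= rho * d * nrm s f.

Let A0 := orthogonalize H M.
Let q := p phi.
Let ps := p phis.
Let H_sym : H^T = H. Proof. by case: H_sqrt. Qed.
Let H_unit : H \in unitmx. Proof. exact: sqrt_unitmx b_indep H_sqrt. Qed.
Let F_D v w : F (v + w) = F v + F w := ortho_combD H b_L2 v w.
Let F_Z a v : F (a *: v) = a *: F v := ortho_combZ H b_L2 a v.
Let F_ip v w : s (F v) (F w) = dot v w := ortho_comb_ip b_L2 b_indep H_sqrt v w.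
Let ps_ip w : dot ps w = s phis (F w).
Proof. exact: ortho_coordE. Qed.
Let q_ip w : dot q w = s phi (F w).
Proof. exact: ortho_coordE. Qed.
Let A0_ip v w : dot v (A0 *m w) = s (F v) (T (F w)).
Proof. exact: (orthogonalize_ip H_sqrt T_adj M_E). Qed.
Let T_bound := adjoint_bound T_adj T_le.

Let A0_T w : nrm s (F (A0 *m w) - T (F w)) <= d / 2 * nrm dot w.
Proof.
rewrite /A0 (galerkin_coord H_sqrt T_adj M_E) (le_trans (proj_half _)) //.
by rewrite (F_nrm F_ip).
Qed.

Let q_phi : nrm s (F q - phi) <= d.
Proof.
have pT : p (T phi) = rho *: q.
  apply/esym/(ortho_coord_uniq H_sqrt) => w.
  rewrite ipZl q_ip; have := nrm_eq0_ip (F w) T_phi; rewrite ipBl ipZl => h.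
  by apply/eqP; rewrite eq_sym -subr_eq0; apply/eqP.
have := proj_rho phi; rewrite pT F_Z phi1 mulr1 => h.
rewrite -(ler_pM2l rho_gt0) -{1}(gtr0_norm rho_gt0) -nrmZ; apply: le_trans h.
have -> : nrm s (rho *: (F q - phi)) = nrm s ((rho *: F q - T phi) + (T phi - rho *: phi)).
  by nrm_ring.
by rewrite (le_trans (nrmD _ _ _)) // T_phi addr0.
Qed.

Let d_c4 : 4 * d <= c.
Proof.
have B0 : 0 <= B by rewrite /B mulr_ge0 ?addr_ge0 ?divr_ge0 // ltW.
have : 0 <= B * (2 + K + rho) by rewrite mulr_ge0 // !addr_ge0 // ltW.
move=> /(ler_wpM2r (ltW d_gt0)); have := d_c; rewrite /D2; have := d_gt0; lra.
Qed.

Lemma near_matrix_eigen (A : 'M[R]_k) :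
  (forall w, nrm dot (A *m w - A0 *m w) <= d / 2 * nrm dot w) ->
  exists (r : R) (x : 'cV[R]_k), [/\ x != 0, rho - c <= r & A *m x = r *: x].
Proof.
move=> AA0.
have A_T := perturbed_T F_D F_Z F_ip A0_T AA0.
have [r [x [x0 rx Ax]]] := exists_eigen T_phis phi1 phis1 c_gt0 T_low
  F_D F_Z F_ip ps_ip A_T (ltW d_gt0) q_phi d_c4 eps_gt0 eps_c eps_phi d_le1 d_eps.
by exists r, x; split=> //; move: rx; rewrite ler_norml => /andP[]; have := eps_c; lra.
Qed.

Lemma population_eigen_exists : exists r, largest_gen_eigenvalue M (H *m H) r.
Proof.
have [w|r [x [x0 _ Ax]]] := @near_matrix_eigen A0.
  by rewrite subrr nrm0 mulr_ge0 ?nrm_ge0 // divr_ge0 // ltW.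
apply: (gen_eigenvalue_largest (r := r)); first by rewrite unitmx_mul H_unit.
apply: (gen_eigenvalue_orthogonalize H_unit x0).
by rewrite (orthogonalize_sqr H_unit) mul1mx.
Qed.

(** The maximum dominates the eigenvalue found near [rho]. This one-sided bound suffices to enter
    the range of the eigenvector estimates. *)
Lemma population_eigen_ge (r : R) : largest_gen_eigenvalue M (H *m H) r -> rho - c <= r.
Proof.
move=> [_ rmax]; have [w|r' [x [x0 rr' Ax]]] := @near_matrix_eigen A0.
  by rewrite subrr nrm0 mulr_ge0 ?nrm_ge0 // divr_ge0 // ltW.
apply: (le_trans rr'); apply: rmax; apply: (gen_eigenvalue_orthogonalize H_unit x0).
by rewrite (orthogonalize_sqr H_unit) mul1mx.
Qed.

Section sample.
Variables (Gw Mw : 'M[R]_k).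
Let Go := orthogonalize H Gw.
Let Mo := orthogonalize H Mw.
Hypothesis Gw_sym : Gw^T = Gw.
Hypothesis Go_1 : forall w, nrm dot ((Go - 1%:M) *m w) <= e * nrm dot w.
Hypothesis Mo_A0 : forall w, nrm dot ((Mo - A0) *m w) <= e * nrm dot w.

Let A0_K w : nrm dot (A0 *m w) <= K * nrm dot w.
Proof. exact: (A0_le K_ge0 F_ip T_le A0_ip). Qed.
Let Go_unit : Go \in unitmx.
Proof. exact: gram_unitmx e_half Go_1. Qed.
Let A1 := invmx Go *m Mo.
(* The sample left eigenvectors are those of [A2], not of [A1]: transposing [A2]
   gives [invmx Go *m Mo^T]. *)
Let A2 := Mo *m invmx Go.

Let e_d (w : 'cV[R]_k) : 2 * e * (1 + K) * nrm dot w <= d / 2 * nrm dot w.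
Proof. by rewrite ler_wpM2r ?nrm_ge0 //; have := e_K; lra. Qed.

Let A1_A0 w : nrm dot (A1 *m w - A0 *m w) <= d / 2 * nrm dot w.
Proof. exact: le_trans (gram_inv_mull e_half A0_K Go_1 Mo_A0 w) (e_d w). Qed.

Let A2_A0 w : nrm dot (A2 *m w - A0 *m w) <= d / 2 * nrm dot w.
Proof. exact: le_trans (gram_inv_mulr K_ge0 e_half A0_K Go_1 Mo_A0 w) (e_d w). Qed.

Lemma sample_gen_eigenvalue (r : R) (x : 'cV[R]_k) :
  x != 0 -> A1 *m x = r *: x -> gen_eigenvalue Mw Gw r.
Proof.
move=> x0 Ax; apply: (gen_eigenvalue_orthogonalize H_unit x0).
by rewrite -/Mo -/Go -[Mo](mulKVmx Go_unit) -mulmxA Ax -scalemxAr.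
Qed.

Lemma sample_eigen_exists : exists r, largest_gen_eigenvalue Mw Gw r.
Proof.
have [r [x [x0 _ Ax]]] := near_matrix_eigen A1_A0.
apply: (gen_eigenvalue_largest (r := r)); last exact: sample_gen_eigenvalue Ax.
exact: (orthogonalize_unitmx Go_unit).
Qed.

Lemma sample_eigen_ge (r : R) : largest_gen_eigenvalue Mw Gw r -> rho - c <= r.
Proof.
move=> [_ rmax]; have [r' [x [x0 rr' Ax]]] := near_matrix_eigen A1_A0.
by apply: (le_trans rr'); apply: rmax; exact: sample_gen_eigenvalue Ax.
Qed.

Variables (rk rh : R) (c0 c0s ch chs : 'cV[R]_k).
Hypothesis pop_eigen : largest_gen_eigen M (H *m H) rk c0 c0s.
Hypotheses (c0_1 : nrm dot (H *m c0) = 1) (c0s_1 : nrm dot (H *m c0s) = 1).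
Hypothesis sample_eigen : largest_gen_eigen Mw Gw rh ch chs.
Hypotheses (ch_1 : L2norm Q (sieve_fun b ch) = 1) (chs_1 : L2norm Q (sieve_fun b chs) = 1).

Let fE (v : 'cV[R]_k) : F (H *m v) = sieve_fun b v :> (S -> R).
Proof. exact: ortho_combE b_indep H_sqrt v. Qed.

Let f_1 (v : 'cV[R]_k) : L2norm Q (sieve_fun b v) = 1 -> nrm dot (H *m v) = 1.
Proof. by move=> <-; rewrite -fE L2norm_nrm -(F_nrm F_ip). Qed.

Let pop_right : A0 *m (H *m c0) = rk *: (H *m c0).
Proof.
have [_ _ _ Ec _] := pop_eigen.
by rewrite (orthogonalize_eigen H_unit Ec) (orthogonalize_sqr H_unit) mul1mx.
Qed.

Let pop_left : A0^T *m (H *m c0s) = rk *: (H *m c0s).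
Proof.
have [_ _ _ _ Ec] := pop_eigen.
by rewrite (orthogonalize_left_eigen H_sym H_unit Ec) (orthogonalize_sqr H_unit) trmx1 mul1mx.
Qed.

Let rk_ge : rho - c <= rk.
Proof. by have [El _ _ _ _] := pop_eigen; exact: population_eigen_ge. Qed.

Let rh_ge : rho - c <= rh.
Proof. by have [El _ _ _ _] := sample_eigen; exact: sample_eigen_ge. Qed.

Let Mo_f : Mo *m (H *m ch) = rh *: (Go *m (H *m ch)).
Proof. by have [_ _ _ Ec _] := sample_eigen; exact: orthogonalize_eigen. Qed.

Let Mo_fs : Mo^T *m (H *m chs) = rh *: (Go *m (H *m chs)).
Proof.
have [_ _ _ _ Ec] := sample_eigen.
by rewrite (orthogonalize_left_eigen H_sym H_unit Ec) (orthogonalize_tr H_sym) Gw_sym.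
Qed.

Lemma sample_right_rate (h : R) :
  nrm dot ((A1 - A0) *m (H *m c0)) <= h -> 2 * B * h <= 1 ->
  `|rh - rho| <= 2 * (1 + 8 / c) * (K + 1) * (nrm s (F (p phi) - phi) + h) /\
  (0 <= L2inner Q phi (sieve_fun b ch) ->
   L2norm Q (fun x => sieve_fun b ch x - phi x) <=
     2 * (1 + B * K) * (1 + B) * (nrm s (F (p phi) - phi) + h)).
Proof.
move=> hh Bh.
have A1f : A1 *m (H *m ch) = rh *: (H *m ch).
  by rewrite -mulmxA Mo_f -scalemxAr mulKmx.
have [r1 r2] := right_rate T_bound T_phi T_phis phi1 phis1 K_ge0 rho_gt0 c_gt0 c_gt0 T_low
  F_D F_Z F_ip ps_ip d_gt0 d_le1 d_c d_c2 d_BK q_ip q_phi A0_ip A0_T rk_ge pop_right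
  c0_1 A1_A0 rh_ge A1f (f_1 ch_1) hh Bh.
split=> // sgn; rewrite -fE.
rewrite -[L2norm _ _]/(L2norm Q (F (H *m ch) - phi)) L2norm_nrm.
by apply: r2; rewrite /= fE.
Qed.

Lemma sample_left_rate (h : R) :
  nrm dot ((invmx Go *m Mo^T - A0^T) *m (H *m c0s)) <= h ->
  0 <= L2inner Q phis (sieve_fun b chs) ->
  L2norm Q (fun x => sieve_fun b chs x - phis x) <=
     2 * (1 + 2 * (2 / c * (1 + 4 / c)) * K) * (1 + 2 / c * (1 + 4 / c)) *
     (nrm s (F (p phis) - phis) + h).
Proof.
move=> hh sgn.
have GoT : Go^T = Go by rewrite /Go (orthogonalize_tr H_sym) Gw_sym.
have A2T : A2^T = invmx Go *m Mo^T by rewrite trmx_mul trmx_inv GoT.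
have Gf0 : 0 < nrm dot (Go *m (H *m ch)).
  by apply: lt_le_trans (gram_low e_half Go_1 _); rewrite (f_1 ch_1) mulr1.
(* Passing from [A1] to [A2], its conjugate by [Go], multiplies right eigenvectors by [Go]; the
   lower bound on [Go] allows normalization. *)
pose f2 := (nrm dot (Go *m (H *m ch)))^-1 *: (Go *m (H *m ch)).
have f2_1 : nrm dot f2 = 1 by rewrite nrmZ gtr0_norm ?invr_gt0 // mulVf // gt_eqF.
have A2f : A2 *m f2 = rh *: f2.
  by rewrite /A2 -mulmxA -!scalemxAr mulKmx // Mo_f !scalerA mulrC.
have A2fs : A2^T *m (H *m chs) = rh *: (H *m chs).
  by rewrite A2T -mulmxA Mo_fs -scalemxAr mulKmx.
rewrite -fE -[L2norm _ _]/(L2norm Q (F (H *m chs) - phis)) L2norm_nrm.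
apply: (left_rate T_bound T_phi T_phis phi1 phis1 K_ge0 rho_gt0 c_gt0 c_gt0 T_low
  F_D F_Z F_ip ps_ip T_le d_gt0 d_le1 d_c d_c2 q_phi A0_ip A0_T rk_ge pop_right pop_left
  c0_1 c0s_1 A2_A0 rh_ge A2f A2fs f2_1 (f_1 chs_1)).
  by rewrite A2T.
by rewrite /= fE.
Qed.

End sample.
End sieve_estimator.

Section operator_bounds.
Context {dS : measure_display} {S : measurableType dS} {R : realType}.
Variable Q : probability S R.
Local Notation V := (LfunType Q two_ge1).
Local Notation s := (L2ip Q).

Lemma L2opnorm_le (U : (S -> R) -> (S -> R)) (W : V -> V) (C : R) :
  (forall f : V, U f = W f) -> (forall a f, nrm s (W (a *: f)) = `|a| * nrm s (W f)) ->
  (L2opnorm Q U <= C%:E)%E -> forall f, nrm s (W f) <= C * nrm s f.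
Proof.
move=> UW hom UC.
have unit f : nrm s f <= 1 -> nrm s (W f) <= C.
  move=> f1; rewrite -lee_fin EFin_nrm -UW; apply: le_trans UC; apply: ereal_sup_ubound.
  by exists f => //; split; [exact: L2P|rewrite L2norm_nrm].
move=> f; have := nrm_ge0 s f; rewrite le_eqVlt => /orP[/eqP f0|f0].
  rewrite -f0 mulr0; have W0 := nrm_ge0 s (W f).
  have C0 : 0 <= C by apply: le_trans W0 (unit f _); rewrite -f0 ler01.
  (* A vector of norm 0 stays in the unit ball under scaling, so a nonzero image could be blown up
     beyond [C]. *)
  rewrite leNgt; apply/negP => Wf; have := unit (((C + 1) / nrm s (W f)) *: f).
  rewrite nrmZ -f0 mulr0 ler01 hom => /(_ isT).
  rewrite ger0_norm ?divr_ge0 ?addr_ge0 // mulfVK ?gt_eqF //; lra.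
have := unit ((nrm s f)^-1 *: f); rewrite nrmZ hom gtr0_norm ?invr_gt0 //.
rewrite mulVf ?gt_eqF // lexx => /(_ isT).
by rewrite mulrC ler_pdivrMr.
Qed.

(** A zero integral would make the product both zero and positive almost everywhere, hence the whole
    space null. *)
Lemma L2positive_inner_gt0 (f g : V) : L2positive Q f -> L2positive Q g -> 0 < L2inner Q f g.
Proof.
move=> f0 g0.
have pos : {ae Q, forall x, 0 < f x * g x}.
  by apply: filterS2 f0 g0 => x fx gx; rewrite mulr_gt0.
have mfg : measurable_fun [set: S] (fun x => (f x * g x)%:E).
  by case/integrableP: (L2_integrableM (L2P f) (L2P g)).
have E : (L2inner Q f g)%:E = (\int[Q]_x `|(f x * g x)%:E|)%E.
  rewrite (EFin_L2inner (L2P f) (L2P g)); apply: ae_eq_integral => //.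
    exact: measurableT_comp.
  by apply: filterS pos => x fgx _; rewrite gee0_abs // lee_fin ltW.
rewrite lt_def -!lee_fin E integral_ge0 ?andbT //.
apply/eqP => fg0; move: E; rewrite fg0 => /esym.
move=> /(ae_eq_integral_abs Q measurableT mfg) ae0.
have : {ae Q, forall x : S, False}.
  by apply: filterS2 pos ae0 => x fgx /(_ I) [] fgx0; move: fgx; rewrite fgx0 ltxx.
move=> [N [mN N0 TN]].
have : Q [set: S] = 0%E.
  apply/eqP; rewrite -measure_le0 -N0 le_measure ?inE //.
  by apply: subset_trans TN => x _ [].
by rewrite probability_setT => /eqP; rewrite onee_eq0.
Qed.

End operator_bounds.

Lemma small_constant {R : realType} (l : seq R) : all (fun x => 0 < x) l ->
  exists2 d : R, 0 < d & forall x, x \in l -> d <= x.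
Proof.
elim: l => [_|x l IHl /= /andP[x0 /IHl[d d0 dl]]]; first by exists 1.
exists (Num.min x d); first by rewrite lt_min x0.
by move=> y; rewrite inE ge_min => /orP[/eqP ->|/dl ->]; rewrite ?lexx ?orbT.
Qed.

Lemma mxopnorm_nrm {R : realType} (k : nat) (A : 'M[R]_k) (e : R) :
  `|mxopnorm A| <= e -> forall w, nrm dot (A *m w) <= e * nrm dot w.
Proof.
move=> Ae w; apply: le_trans (enorm_mulmx_le A w) _.
by apply: (ler_wpM2r (nrm_ge0 dot w)); exact: le_trans (ler_norm _) Ae.
Qed.

Lemma L2norm_ge0 {d : measure_display} {S : measurableType d} {R : realType}
  (Q : probability S R) (f : S -> R) : 0 <= L2norm Q f.
Proof. by rewrite /L2norm fine_ge0 // Lnorm_ge0. Qed.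

(** The constant supplied by [Op] has no sign; [1 + |C3|] dominates both 1 and [C3]. *)
Lemma rate_absorb {R : realType} (C C3 x y : R) : 0 <= C -> 0 <= x -> 0 <= y ->
  C * (x + C3 * y) <= C * (1 + `|C3|) * (x + y).
Proof.
move=> C0 x0 y0; rewrite -mulrA ler_wpM2l //.
have := ler_wpM2r y0 (ler_norm C3); have : 0 <= `|C3| * x by rewrite mulr_ge0.
lra.
Qed.

Section sample_matrices.
Context {dO dS : measure_display} {Omega : measurableType dO}
  {S : measurableType dS} {R : realType}.
Variables (P : probability Omega R) (Q : probability S R) (X : nat -> {RV P >-> S}).
Hypothesis X_law : forall t A, measurable A -> P (X t @^-1` A) = Q A.
Variables (k : nat) (b : 'I_k -> S -> R).
Hypothesis b_L2 : forall i, L2 Q (b i).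

Lemma Gmx_law : Gmx X b = \matrix_(i, j) L2inner Q (b i) (b j).
Proof.
apply/matrixP => i j; rewrite !mxE /Rintegral /L2inner /Rintegral; congr fine.
rewrite -(@integral_law _ _ _ _ _ P Q (X 0) (fun x => (b i x * b j x)%:E)) //; first exact: X_law.
by case/integrableP: (L2_integrableM (b_L2 i) (b_L2 j)).
Qed.

Lemma Mmx_kernel (m : S -> S -> R) (T T' : (S -> R) -> (S -> R)) i j :
  (forall w, 0 <= m (X 0 w) (X 1 w)) -> (forall psi, L2 Q psi -> L2 Q (T psi)) ->
  L2adjoint Q T T' ->
  (forall psi, L2 Q psi ->
    is_cond_exp P (fun w => m (X 0 w) (X 1 w) * psi (X 1 w)) (X 0) (T psi)) ->
  Mmx X b m i j = L2inner Q (b i) (T (b j)).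
Proof.
move=> m0 TL adj cond; rewrite mxE.
by rewrite -(@kernel_inner _ _ _ _ _ P Q (X 0) (X 1) (fun w => m (X 0 w) (X 1 w)) T T') //;
  exact: X_law.
Qed.

Lemma Ghatmx_sym n w : (Ghatmx X b n w)^T = Ghatmx X b n w.
Proof.
by apply/matrixP => i j; rewrite !mxE; congr (_ * _); apply: eq_bigr => t _; rewrite mulrC.
Qed.

End sample_matrices.

Theorem theorem3p1
  (R : realType) (dO : measure_display) (Omega : measurableType dO)
  (P : probability Omega R) (dim : nat)
  (* the process and its state space calX *)
  (calX : set (dim.-tuple R))
  (X : nat -> {RV P >-> dim.-tuple R})
  (Q : probability (dim.-tuple R) R)
  (calX_meas : measurable calX)
  (X_in : forall t w, calX (X t w))
  (X_law : forall t A, measurable A -> P (X t @^-1` A) = Q A)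
  (X_markov : homogeneous_markov X)
  (X_stationary : strictly_stationary X)
  (X_ergodic : ergodic X)
  (* the function m, the operator and its adjoint *)
  (m : dim.-tuple R -> dim.-tuple R -> R)
  (m_meas : measurable_fun (calX `*` calX) (fun z => m z.1 z.2))
  (m_gt0 : forall x y, calX x -> calX y -> 0 < m x y)
  (Mop Mst : (dim.-tuple R -> R) -> (dim.-tuple R -> R))
  (Mop_cond : forall psi t, L2 Q psi ->
    is_cond_exp P (fun w => m (X t w) (X t.+1 w) * psi (X t.+1 w))
      (X t) (Mop psi))
  (Mst_cond : forall psi t, L2 Q psi ->
    is_cond_exp P (fun w => m (X t w) (X t.+1 w) * psi (X t w))
      (X t.+1) (Mst psi))
  (Mst_adj : L2adjoint Q Mop Mst)
  (* the sieve *)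
  (b : forall k, 'I_k -> dim.-tuple R -> R)
  (b_L2 : forall k i, L2 Q (b k i))
  (b_indep : forall k, L2_lin_indep Q (b k))
  (k : nat -> nat)
  (k_infty : k n @[n --> \oo] --> \oo)
  (Gh : forall n, 'M[R]_(k n))
  (Gh_sqrt : forall n, is_psd_sqrt (Gmx X (b (k n))) (Gh n))
  (rhok : nat -> R) (c cs : forall n, 'cV[R]_(k n))
  (ck_def : forall n,
    (exists r, largest_gen_eigenvalue
       (Mmx X (b (k n)) m) (Gmx X (b (k n))) r) ->
    [/\ largest_gen_eigen (Mmx X (b (k n)) m) (Gmx X (b (k n)))
          (rhok n) (c n) (cs n),
        enorm (Gh n *m c n) = 1 & enorm (Gh n *m cs n) = 1])
  (* the estimators; the two disjuncts are the cases of known and estimated m *)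
  (Mhat : forall n, Omega -> 'M[R]_(k n))
  (Mhat_def :
    (forall n w, Mhat n w = Mhatmx X (b (k n)) m n w) \/
    (exists (Alpha : Type)
            (ma : Alpha -> dim.-tuple R -> dim.-tuple R -> R)
            (alpha0 : Alpha) (alphahat : nat -> Omega -> Alpha),
       (forall x y, calX x -> calX y -> ma alpha0 x y = m x y) /\
       (forall n w,
          Mhat n w = Mhatmx X (b (k n)) (ma (alphahat n w)) n w)))
  (rho : R) (phi phis : dim.-tuple R -> R)
  (rhohat : nat -> Omega -> R) (chat chats : forall n, Omega -> 'cV[R]_(k n))
  (hat_def : forall n w,
    (exists r, largest_gen_eigenvalue
       (Mhat n w) (Ghatmx X (b (k n)) n w) r) ->
    [/\ largest_gen_eigen (Mhat n w) (Ghatmx X (b (k n)) n w)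
          (rhohat n w) (chat n w) (chats n w),
        L2norm Q (sieve_fun (b (k n)) (chat n w)) = 1 /\
        L2norm Q (sieve_fun (b (k n)) (chats n w)) = 1,
        0 <= L2inner Q phi (sieve_fun (b (k n)) (chat n w)) &
        0 <= L2inner Q phis (sieve_fun (b (k n)) (chats n w))])
  (* the assumptions *)
  (A1 : perron_frobenius Q Mop Mst rho phi phis)
  (phi_norm : L2norm Q phi = 1) (phis_norm : L2norm Q phis = 1)
  (A2 : L2opnorm Q (fun psi x =>
          sieve_proj Q (b (k n)) (Mop psi) x - Mop psi x)
        @[n --> \oo] --> 0%E)
  (A3G : op1 P (fun n w =>
     mxopnorm (orthogonalize (Gh n) (Ghatmx X (b (k n)) n w) - 1%:M)))
  (A3M : op1 P (fun n w =>
     mxopnorm (orthogonalize (Gh n) (Mhat n w)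
               - orthogonalize (Gh n) (Mmx X (b (k n)) m))))
  (eta etas : nat -> R)
  (eta_gt0 : forall n, 0 < eta n) (etas_gt0 : forall n, 0 < etas n)
  (eta_o1 : eta n @[n --> \oo] --> 0) (etas_o1 : etas n @[n --> \oo] --> 0)
  (eta_rate : Op P (fun n w =>
     enorm ((invmx (orthogonalize (Gh n) (Ghatmx X (b (k n)) n w))
               *m orthogonalize (Gh n) (Mhat n w)
             - orthogonalize (Gh n) (Mmx X (b (k n)) m))
            *m (Gh n *m c n))) eta)
  (etas_rate : Op P (fun n w =>
     enorm ((invmx (orthogonalize (Gh n) (Ghatmx X (b (k n)) n w))
               *m (orthogonalize (Gh n) (Mhat n w))^T
             - (orthogonalize (Gh n) (Mmx X (b (k n)) m))^T)
            *m (Gh n *m cs n))) etas) :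
  let delta n := L2norm Q (fun x => sieve_proj Q (b (k n)) phi x - phi x) in
  let deltas n := L2norm Q (fun x => sieve_proj Q (b (k n)) phis x - phis x) in
  [/\ Op P (fun n w => rhohat n w - rho) (fun n => delta n + eta n),
      Op P (fun n w => L2norm Q (fun x =>
              sieve_fun (b (k n)) (chat n w) x - phi x))
         (fun n => delta n + eta n) &
      Op P (fun n w => L2norm Q (fun x =>
              sieve_fun (b (k n)) (chats n w) x - phis x))
         (fun n => deltas n + etas n)].
Proof.
move=> delta deltas.
have [TL Tfin] := pf_bounded A1.
pose V := LfunType Q two_ge1; pose s := L2ip Q.
pose T (f : V) : V := Lfun_Sub two_ge1 (TL f (L2P f)).
pose T' (f : V) : V := Lfun_Sub two_ge1 (proj1 (Mst_adj _ (L2P f))).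
have T_adj x y : s (T x) y = s x (T' y) := proj2 (Mst_adj _ (L2P y)) x (L2P x).
have T_hom a f : nrm s (T (a *: f)) = `|a| * nrm s (T f).
  by rewrite -nrmZ; apply: nrm_ext => z; rewrite ipZl !T_adj ipZl.
have [K K0 KE] : exists2 K : R, 0 <= K & (L2opnorm Q Mop <= K%:E)%E.
  case: (L2opnorm Q Mop) Tfin => [r _|//|_]; last by exists 0 => //; exact: leNye.
  by exists (Num.max 0 r); rewrite ?lee_fin le_max ?lexx ?orbT.
have T_le : forall f, nrm s (T f) <= K * nrm s f by exact: L2opnorm_le KE.
have phiL : L2 Q phi by case: (pf_phi A1).
have phisL : L2 Q phis by case: (pf_phis A1).
pose phiV : V := Lfun_Sub two_ge1 phiL; pose phisV : V := Lfun_Sub two_ge1 phisL.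
have phi1 : nrm s phiV = 1 by rewrite -L2norm_nrm.
have phis1 : nrm s phisV = 1 by rewrite -L2norm_nrm.
have rho_gt0 := pf_rho_gt0 A1.
have T_phi : nrm s (T phiV - rho *: phiV) = 0.
  by apply/nrmB0_ae; case: (pf_phi A1).
have T'_phis : nrm s (T' phisV - rho *: phisV) = 0.
  by apply/nrmB0_ae; case: (pf_phis A1).
have T_phis x : s phisV (T x) = rho * s phisV x.
  apply/eqP; rewrite -subr_eq0 -ipZl ipC T_adj ipC -ipBl; apply/eqP.
  exact: nrm_eq0_ip.
have phi_phis : 0 < s phisV phiV.
  exact: (L2positive_inner_gt0 (f := phisV) (g := phiV) (pf_phis_pos A1) (pf_phi_pos A1)).
have eig_le z (x : V) : nrm s (T x - z *: x) = 0 -> nrm s x != 0 -> z <= rho.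
  move=> Tx x0; have [_ /(_ (z, 0))] := pf_largest A1.
  rewrite /= expr0n addr0 sqrtr_sqr => zr; apply: le_trans (ler_norm z) (zr _).
  (* A real eigenvector is a complex one with zero imaginary part. *)
  exists (x : dim.-tuple R -> R, cst 0); split.
  - by split; [exact: L2P|exact: (L2P (0 : V))].
  - by move=> [/nrm0_ae x0' _]; rewrite x0' eqxx in x0.
  - have T0 : nrm s (T 0) = 0 by have := T_hom 0 0; rewrite scale0r normr0 mul0r.
    split; rewrite /=.
      move/nrmB0_ae: Tx; apply: filterS => y /= H /H ->.
      by rewrite mul0r subr0 subrr.
    move/nrm0_ae: T0; apply: filterS => y H _; have -> : Mop (cst 0) y = 0 by exact: H.
    by rewrite mulr0 mul0r addr0 subrr.
have eig_simple (x : V) : nrm s (T x - rho *: x) = 0 ->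
    exists a : R, nrm s (x - a *: phiV) = 0.
  move=> Tx; have [f0 [[f0L _] _ f0P]] := pf_simple A1.
  pose f0V : V := Lfun_Sub two_ge1 f0L.
  (* Simplicity supplies some eigenfunction [f0]; [phi] is a nonzero multiple of it and can replace
     it. *)
  have [a1 /(nrmB0_ae phiV (a1 *: f0V)) e1] := f0P phi (pf_phi A1).
  have [a2 /(nrmB0_ae x (a2 *: f0V)) e2] :
      exists a : R, ae_eq Q [set: dim.-tuple R] x (fun y => a * f0 y).
    by apply: f0P; split; [exact: L2P|exact: (proj1 (nrmB0_ae (T x) (rho *: x)) Tx)].
  have a10 : a1 != 0.
    apply: contra_eq_neq phi1 => a10; move: e1; rewrite a10 scale0r subr0 => ->.
    by rewrite eq_sym oner_eq0.
  exists (a2 / a1); apply/eqP; rewrite -normr_le0 ger0_norm ?nrm_ge0 //.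
  have -> : nrm s (x - (a2 / a1) *: phiV) =
      nrm s ((x - a2 *: f0V) - (a2 / a1) *: (phiV - a1 *: f0V)).
    apply: nrm_ext => y; rewrite !(ipBl, ipZl); field; exact: a10.
  by rewrite (le_trans (nrmB _ _ _)) // nrmZ e1 e2 mulr0 addr0.
have Gsqrt n : is_psd_sqrt (\matrix_(i, j) L2inner Q (b (k n) i) (b (k n) j)) (Gh n).
  by rewrite -(Gmx_law X_law) //; exact: Gh_sqrt.
pose F n := ortho_comb (Gh n) (b_L2 (k n)).
pose p n := ortho_coord (Gh n) (b_L2 (k n)).
have projE n (f : V) : sieve_proj Q (b (k n)) f = F n (p n f).
  exact: (sieve_projE (b_L2 (k n)) (b_indep (k n)) (Gsqrt n)).
have A2F e : 0 < e -> \forall n \near \oo, forall f : V,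
    nrm s (F n (p n (T f)) - T f) <= e * nrm s f.
  move=> e0; have := cvge_near_lt A2 (_ : (0 < e%:E)%E); rewrite lte_fin => /(_ e0).
  apply: filterS => n /ltW Ae f.
  apply: (L2opnorm_le (W := fun f => F n (p n (T f)) - T f) _ _ Ae) => {}f.
    by rewrite -[Mop f]/(T f : dim.-tuple R -> R) projE.
  move=> g; rewrite -nrmZ; apply: nrm_ext => z.
  have -> : p n (T (f *: g)) = f *: p n (T g).
    apply/esym/(ortho_coord_uniq (Gsqrt n)) => w.
    by rewrite ipZl (ortho_coordE (b_L2 (k n)) (Gsqrt n)) !T_adj ipZl.
  by rewrite /F ortho_combZ !(ipBl, ipZl) !T_adj ipZl; ring.
have T_fin e : 0 < e -> exists (j : nat) (F : 'cV[R]_j -> V) (p : V -> 'cV[R]_j) (C : R),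
    [/\ forall v w, nrm s (F v - F w) = nrm dot (v - w),
      forall x, nrm s x <= 1 -> nrm dot (p x) <= C &
      forall x, nrm s x <= 1 -> nrm s (F (p x) - T x) <= e].
  move=> e0; have [n nP] := filter_ex (A2F e e0).
  have F_ip v w := ortho_comb_ip (b_L2 (k n)) (b_indep (k n)) (Gsqrt n) v w.
  exists (k n), (F n), (fun x => p n (T x)), K; split=> [v w|x x1|x x1].
  - rewrite -(F_nrm F_ip); congr (nrm s _).
    by rewrite (F_B (ortho_combD (Gh n) (b_L2 (k n))) (ortho_combZ (Gh n) (b_L2 (k n)))).
  - rewrite (le_trans (ortho_coord_le (b_L2 (k n)) (b_indep (k n)) (Gsqrt n) _)) //.
    by rewrite (le_trans (T_le x)) // ler_piMr.
  - by rewrite (le_trans (nP x)) // ler_piMr // ltW.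
have [cc cpos T_low] := deflation_low T_adj T_le T_phis K0 rho_gt0 phi_phis eig_le eig_simple
  (@L2_complete _ _ _ Q) T_fin.
pose B := 4 / cc * (1 + 4 / cc); pose D2 := 2 * (B * (2 + K + rho) + 1).
(* Halving gives the strict inequality [eps < <phis, phi>] needed for the sign change. *)
pose eps := Num.min cc (s phisV phiV / 2).
have B0 : 0 < B by rewrite /B mulr_gt0 ?addr_gt0 ?divr_gt0.
have BK0 : 0 <= B * K by rewrite mulr_ge0 // ltW.
have D20 : 0 < D2.
  have : 0 <= B * (2 + K + rho) by rewrite mulr_ge0 ?(ltW B0) // !addr_ge0 // ltW.
  by rewrite /D2; lra.
have eps0 : 0 < eps by rewrite lt_min cpos divr_gt0.
have epsc : eps <= cc by rewrite ge_min lexx.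
have epsg : eps < s phisV phiV.
  by rewrite gt_min; apply/orP; right; rewrite gtr_pMr // invf_lt1 // ltr1n.
have c8 : 0 < 1 + 8 / cc by rewrite addr_gt0 // divr_gt0.
have BK1 : 0 < 1 + B * K by rewrite ltr_pwDl.
(* One entry per smallness condition, in the order of [d1], [dc], [dc2], [dBK], [deps]; the factor 2
   in the last one makes it strict. None depends on [n]. *)
have [d d0 dP] := @small_constant R [:: 1; cc / (4 * D2); cc ^+ 2 / 32;
    (2 * (1 + B * K))^-1; eps / (2 * (1 + 8 / cc))] (introT and5P
  (And5 ltr01 (divr_gt0 cpos (mulr_gt0 (ltr0Sn _ 3) D20))
    (divr_gt0 (exprn_gt0 2 cpos) (ltr0Sn _ 31))
    (etrans (invr_gt0 _) (mulr_gt0 (ltr0Sn _ 1) BK1))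
    (introT andP (conj (divr_gt0 eps0 (mulr_gt0 (ltr0Sn _ 1) c8)) isT)))).
have d1 : d <= 1 by apply: dP; rewrite !inE eqxx ?orbT.
have dc : 4 * (D2 * d) <= cc.
  have : d <= cc / (4 * D2) by apply: dP; rewrite !inE eqxx ?orbT.
  have D24 : 0 < 4 * D2 by exact: mulr_gt0.
  by rewrite (ler_pdivlMr _ _ D24) => h; apply: le_trans h;
    rewrite le_eqVlt; apply/orP; left; apply/eqP; ring.
have dc2 : 32 * d <= cc ^+ 2.
  have : d <= cc ^+ 2 / 32 by apply: dP; rewrite !inE eqxx ?orbT.
  by rewrite ler_pdivlMr // mulrC.
have dBK : 2 * (1 + B * K) * d <= 1.
  have : d <= (2 * (1 + B * K))^-1 by apply: dP; rewrite !inE eqxx ?orbT.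
  by rewrite -div1r ler_pdivlMr ?mulr_gt0 // mulrC.
have deps : d * (1 + 8 / cc) < eps.
  have : d <= eps / (2 * (1 + 8 / cc)) by apply: dP; rewrite !inE eqxx ?orbT.
  rewrite ler_pdivlMr ?mulr_gt0 // => h; apply: lt_le_trans h.
  by rewrite mulrCA ltr_pMl ?ltr1n // mulr_gt0.
pose e := Num.min 2^-1 (d / (4 * (1 + K))).
have K1 : 0 < 1 + K by rewrite ltr_pwDl.
have e0 : 0 < e by rewrite lt_min invr_gt0 ltr0Sn divr_gt0 // mulr_gt0.
have e_half : e <= 2^-1 by rewrite ge_min lexx.
have e_K : 4 * e * (1 + K) <= d.
  have : e <= d / (4 * (1 + K)) by rewrite ge_min lexx orbT.
  by rewrite ler_pdivlMr ?mulr_gt0 // => h; apply: le_trans h;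
    rewrite le_eqVlt; apply/orP; left; apply/eqP; ring.
have [H1 H2] : (\forall n \near \oo, forall f : V,
    nrm s (F n (p n (T f)) - T f) <= d / 2 * nrm s f) /\
  (\forall n \near \oo, forall f : V, nrm s (F n (p n (T f)) - T f) <= rho * d * nrm s f).
  by split; apply: A2F; [exact: divr_gt0|exact: mulr_gt0].
have deltaE n : delta n = nrm s (F n (p n phiV) - phiV).
  by rewrite /delta (projE n phiV); exact: (L2norm_nrm (F n (p n phiV) - phiV)).
have deltasE n : deltas n = nrm s (F n (p n phisV) - phisV).
  by rewrite /deltas (projE n phisV); exact: (L2norm_nrm (F n (p n phisV) - phisV)).
have M_E n i j : Mmx X (b (k n)) m i j =
    s (basis_fun (b_L2 (k n)) i) (T (basis_fun (b_L2 (k n)) j)).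
  apply: (Mmx_kernel X_law (b_L2 (k n)) i j _ TL Mst_adj (fun psi => Mop_cond psi 0%N)).
  by move=> w; rewrite ltW // m_gt0.
have GH n : Gmx X (b (k n)) = Gh n *m Gh n by case: (Gh_sqrt n).
pose B2 := 2 / cc * (1 + 4 / cc).
pose Ca := 2 * (1 + 8 / cc) * (K + 1).
pose Cb := 2 * (1 + B * K) * (1 + B).
pose Cc := 2 * (1 + 2 * B2 * K) * (1 + B2).
have core n : (forall f : V, nrm s (F n (p n (T f)) - T f) <= d / 2 * nrm s f) ->
    (forall f : V, nrm s (F n (p n (T f)) - T f) <= rho * d * nrm s f) ->
  forall w : Omega,
    `|mxopnorm (orthogonalize (Gh n) (Ghatmx X (b (k n)) n w) - 1%:M)| <= e ->
    `|mxopnorm (orthogonalize (Gh n) (Mhat n w) - orthogonalize (Gh n) (Mmx X (b (k n)) m))| <= e ->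
  (forall h : R,
     enorm ((invmx (orthogonalize (Gh n) (Ghatmx X (b (k n)) n w))
               *m orthogonalize (Gh n) (Mhat n w)
             - orthogonalize (Gh n) (Mmx X (b (k n)) m))
            *m (Gh n *m c n)) <= h -> 2 * B * h <= 1 ->
     `|rhohat n w - rho| <= Ca * (delta n + h) /\
     L2norm Q (fun x => sieve_fun (b (k n)) (chat n w) x - phi x) <= Cb * (delta n + h)) /\
  (forall h : R,
     enorm ((invmx (orthogonalize (Gh n) (Ghatmx X (b (k n)) n w))
               *m (orthogonalize (Gh n) (Mhat n w))^T
             - (orthogonalize (Gh n) (Mmx X (b (k n)) m))^T)
            *m (Gh n *m cs n)) <= h ->
     L2norm Q (fun x => sieve_fun (b (k n)) (chats n w) x - phis x) <= Cc * (deltas n + h)).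
  move=> h1 h2 w y1 y2; have g1 := mxopnorm_nrm y1; have g2 := mxopnorm_nrm y2.
  (* Eigenpairs are specified only where a largest eigenvalue exists, so existence is proved first,
     for the population and then for the sample. *)
  have [pop c_1 cs_1] := ck_def n (eq_ind_r (fun G => exists r, largest_gen_eigenvalue _ G r)
    (population_eigen_exists T_adj T_phi T_phis phi1 phis1 K0 rho_gt0 cpos T_low eps0 epsc
      epsg deps d0 d1 dc (b_indep (k n)) (Gsqrt n) (M_E n) h1 h2) (GH n)).
  have [smp [n1 n2] sg1 sg2] := hat_def n w
    (sample_eigen_exists T_adj T_le T_phi T_phis phi1 phis1 K0 rho_gt0 cpos T_low eps0 epsc
      epsg deps d0 d1 dc e_half e_K (b_indep (k n)) (Gsqrt n) (M_E n) h1 h2 g1 g2).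
  rewrite GH in pop; rewrite deltaE deltasE; split=> h hh.
    move=> Bh; have [r1 r2] := sample_right_rate T_adj T_le T_phi T_phis phi1 phis1 K0 rho_gt0
      cpos T_low eps0 epsc epsg deps d0 d1 dc dc2 dBK e_half e_K (b_indep (k n)) (Gsqrt n)
      (M_E n) h1 h2 g1 g2 pop c_1 smp n1 hh Bh.
    by split=> //; apply: r2.
  exact: (sample_left_rate T_adj T_le T_phi T_phis phi1 phis1 K0 rho_gt0
      cpos T_low eps0 epsc epsg deps d0 d1 dc dc2 e_half e_K (b_indep (k n)) (Gsqrt n)
      (M_E n) h1 h2 (Ghatmx_sym _ _ _ _) g1 g2 pop c_1 cs_1 smp n1 n2 hh sg2).
have Ca0 : 0 <= Ca by rewrite /Ca !mulr_ge0 ?addr_ge0 // ltW // divr_gt0.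
have Cb0 : 0 <= Cb by rewrite /Cb !mulr_ge0 // ltW // addr_gt0.
have B20 : 0 <= B2 by rewrite /B2 mulr_ge0 ?addr_ge0 ?divr_ge0 // ltW.
have BK2 : 0 <= B2 * K by exact: mulr_ge0.
have Cc0 : 0 <= Cc.
  rewrite /Cc; apply: mulr_ge0; last by rewrite addr_ge0.
  by apply: mulr_ge0 => //; rewrite addr_ge0 // -mulrA mulr_ge0.
(* [eta] tending to 0 provides the bound on [h] that keeps the coefficient of the sample eigenvector
   away from 0. *)
have eta_small C3 : \forall n \near \oo, 2 * B * (C3 * eta n) <= 1.
  have BC : 0 < 2 * B * (1 + `|C3|).
    by apply: mulr_gt0; [exact: mulr_gt0|rewrite ltr_pwDl].
  have near0 : \forall n \near \oo, `|0 - eta n| <= (2 * B * (1 + `|C3|))^-1.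
    by apply: (cvgr_dist_le _ _ eta_o1); rewrite invr_gt0.
  apply: filterS near0 => n; rewrite sub0r normrN (gtr0_norm (eta_gt0 n)).
  rewrite -div1r ler_pdivlMr // => /(le_trans _); apply.
  have := ler_wpM2r (ltW (eta_gt0 n)) (ler_norm C3).
  have := mulr_gt0 B0 (eta_gt0 n); have : 0 <= B by exact: ltW.
  by move=> b0 b1 /(ler_wpM2l b0); lra.
have delta_ge0 n : 0 <= delta n by rewrite deltaE nrm_ge0.
have deltas_ge0 n : 0 <= deltas n by rewrite deltasE nrm_ge0.
split.
- apply: (Op_bound A3G A3M eta_rate) => C3; exists e, (Ca * (1 + `|C3|)); split=> //.
  apply: filterS (filterI (filterI H1 H2) (eta_small C3)) => n [[h1 h2] h3] w y1 y2.
  rewrite ger0_norm ?sqrtr_ge0 // => y3; have [r _] := core n h1 h2 w y1 y2.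
  have [r1 _] := r _ y3 h3; apply: le_trans r1 _.
  by apply: rate_absorb => //; exact: ltW.
- apply: (Op_bound A3G A3M eta_rate) => C3; exists e, (Cb * (1 + `|C3|)); split=> //.
  apply: filterS (filterI (filterI H1 H2) (eta_small C3)) => n [[h1 h2] h3] w y1 y2.
  rewrite ger0_norm ?sqrtr_ge0 // => y3; have [r _] := core n h1 h2 w y1 y2.
  have [_ r1] := r _ y3 h3; rewrite ger0_norm ?L2norm_ge0 //; apply: le_trans r1 _.
  by apply: rate_absorb => //; exact: ltW.
- apply: (Op_bound A3G A3M etas_rate) => C3; exists e, (Cc * (1 + `|C3|)); split=> //.
  apply: filterS (filterI H1 H2) => n [h1 h2] w y1 y2.
  rewrite ger0_norm ?sqrtr_ge0 // => y3; have [_ r] := core n h1 h2 w y1 y2.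
  rewrite ger0_norm ?L2norm_ge0 //; apply: le_trans (r _ y3) _.
  by apply: rate_absorb => //; exact: ltW.
Qed.
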